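(* Let $\vartheta_1,\vartheta_2\in\mathbb C^\times$, $\gamma,\chi\in\mathbb C$, $\epsilon\in\{\pm1\}$ with $\vartheta_2=\vartheta_1(2\gamma+\varpi_1)$ and $\vartheta_1\chi=\epsilon$. Let $M$ be an irreducible $\mathscr H^l_{\vartheta_1,\vartheta_2}$-module. Then $\mathcal D^\epsilon_{\mathbf s,\boldsymbol\varepsilon}(M)$ is either $0$ or an irreducible $\mathscr B_{\mathbf s,\boldsymbol\varepsilon}$-module.
   Context: Fix integers $m,n\ge0$, $\kappa=m+n$, a parity sequence $\mathbf s\in\{\pm1\}^\kappa$ with exactly $m$ entries $1$, $s_i=(-1)^{|i|}$, $\boldsymbol\varepsilon\in\{\pm1\}^\kappa$, $G=\mathrm{diag}(\varepsilon_1,\dots,\varepsilon_\kappa)$, $\varpi_1=\sum_as_a\varepsilon_a$, $\jmath=(m-n)/2$. $V=\mathbb C^{m|n}$ with basis $v_i$ of parity $|i|$, matrix units $E_{ij}$, $R(u)=1-\frac1u\sum_{i,j}s_jE_{ij}\otimes E_{ji}$. The twisted super Yangian $\mathscr B_{\mathbf s,\boldsymbol\varepsilon}$ is generated by $b_{ij}^{(r)}$ of parity $|i|+|j|$ with $b_{ij}(u)=\delta_{ij}\varepsilon_i+\sum_rb_{ij}^{(r)}u^{-r}$, $B(u)=\sum(-1)^{|i||j|+|j|}b_{ij}(u)\otimes E_{ij}$, relations $R(u-v)B_1(u)R(u+v)B_2(v)=B_2(v)R(u+v)B_1(u)R(u-v)$, $B(u)B(-u)=1$. Degenerate affine Hecke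 algebra: $\mathscr W_l=\mathbb Z_2\wr\mathfrak S_l$ with transpositions $\sigma_{ij}$, $\sigma_i=\sigma_{i,i+1}$, sign changes $\varsigma_i$; $\mathscr H^l_{\vartheta_1,\vartheta_2}$ is generated by $\mathbb C[\mathscr W_l]$ and commuting $y_1,\dots,y_l$ with $\sigma_iy_i-y_{i+1}\sigma_i=\vartheta_1$, $\varsigma_ly_i=y_i\varsigma_l$ ($i<l$), $\varsigma_ly_l+y_l\varsigma_l=\vartheta_2$, $\sigma_iy_j=y_j\sigma_i$ ($j\ne i,i+1$). Drinfeld functor: $\mathscr W_l$ acts diagonally on $M\otimes V^{\otimes l}$, with $\sigma_{ij}$ acting on $V^{\otimes l}$ by $\sum_{a,b}s_bE^{(i)}_{ab}E^{(j)}_{ba}$ ($E^{(k)}$ = action on $k$-th factor) and $\varsigma_k$ by $G$ on the $k$-th factor; $\mathcal D^\epsilon_{\mathbf s,\boldsymbol\varepsilon}(M)=(M\otimes V^{\otimes l})/(\sum_{i<l}\mathrm{Im}(\sigma_i-\epsilon)+\mathrm{Im}(\varsigma_l-\epsilon))$, with $\mathscr B_{\mathbf s,\boldsymbol\varepsilon}$ acting via $B(u)\mapsto\mathcal T_1(u)\cdots\mathcal T_l(u)(G+\gamma u^{-1})\mathcal S_l(-u)\cdots\mathcal S_1(-u)$, where $\mathcal Q^{(k)}=\sum_{i,j}(-1)^{|i||j|+|i|+|j|}E^{(k)}_{ij}\otimes E_{ij}$, $\mathcal T_k(u)=1+\frac{1}{u-\jmath-\chi y_k}\otimes\mathcal Q^{(k)}$,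 $\mathcal S_k(u)=1-\frac{1}{u+\jmath-\chi y_k}\otimes\mathcal Q^{(k)}$. *)

(* Defs.v *)
From HB Require Import structures.
From mathcomp Require Import all_boot all_order all_algebra.
From mathcomp Require Import complex reals.
Set Implicit Arguments.
Unset Strict Implicit.
Unset Printing Implicit Defensive.
Import GRing.Theory.
Local Open Scope ring_scope.

(*  * par i : bool is the parity |i|, so s_i = (-1)^|i|.                    *)
(*  * The rank of the Hecke algebra is L = l.+1 (so L >= 1, needed for      *)
(*    the generator varsigma_L); tensor positions are 'I_l.+1 (0-based),    *)
(*    sigma_i (1 <= i <= L-1) is indexed by i : 'I_l (0-based), acting on   *)
(*    positions posL i (value i) and posR i (value i+1).                    *)
(*  * M (x) V^{(x)L} is modelled as {ffun Idx -> M}, where Idx are the      *)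
(*    multi-indices of the standard basis v_{a_1} (x) ... (x) v_{a_L}.      *)

Section Defs.
Variable R : realType.
Local Notation C := (R[i]).

Definition sgnC (b : bool) : C := (-1) ^+ b.

Definition is_lin (U : lmodType C) (f : U -> U) : Prop :=
  forall (a : C) (u v : U), f (a *: u + v) = a *: f u + f v.

Definition subspace (U : lmodType C) (P : U -> Prop) : Prop :=
  P 0 /\ forall (a : C) (u v : U), P u -> P v -> P (a *: u + v).

Variables (m n : nat).
Local Notation ka := (m + n)%N.
Variables (par epsb : 'I_ka -> bool).

Definition s_ (i : 'I_ka) : C := sgnC (par i).
Definition eps_ (i : 'I_ka) : C := sgnC (epsb i).
Definition jmath : C := (m%:R - n%:R) / 2%:R.
Definition varpi1 : C := \sum_(a < ka) s_ a * eps_ a.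

Variable l : nat.
Local Notation L := l.+1.

Definition posL (i : 'I_l) : 'I_L := widen_ord (leqnSn l) i.
Definition posR (i : 'I_l) : 'I_L := lift ord0 i.
Definition swp (i : 'I_l) (k : 'I_L) : 'I_L :=
  if k == posL i then posR i else if k == posR i then posL i else k.

Variable M : lmodType C.
(* sg i = sigma_{i+1}, vs k = varsigma_{k+1}, y k = y_{k+1} *)
Variables (sg : 'I_l -> M -> M) (vs y : 'I_L -> M -> M).

Definition is_Hmodule (th1 th2 : C) : Prop :=
  [/\ [/\ (forall i, is_lin (sg i)), (forall k, is_lin (vs k)) & (forall k, is_lin (y k))],
  (* relations of W_L = Z_2 wr S_L *)
   [/\ (forall i v, sg i (sg i v) = v),
       (forall (i j : 'I_l) v, val j = (val i).+1 ->
          sg i (sg j (sg i v)) = sg j (sg i (sg j v))),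
       (forall (i j : 'I_l) v, ((val i).+1 < val j)%N ->
          sg i (sg j v) = sg j (sg i v)),
       (forall k v, vs k (vs k v) = v) &
       (forall k k' v, vs k (vs k' v) = vs k' (vs k v))],
   (forall i k v, sg i (vs k v) = vs (swp i k) (sg i v)) &
   [/\ (forall k k' v, y k (y k' v) = y k' (y k v)),
       (forall i v, sg i (y (posL i) v) - y (posR i) (sg i v) = th1 *: v),
       (forall k v, k != ord_max -> vs ord_max (y k v) = y k (vs ord_max v)),
       (forall v, vs ord_max (y ord_max v) + y ord_max (vs ord_max v) = th2 *: v) &
       (forall i k v, k != posL i -> k != posR i -> sg i (y k v) = y k (sg i v))]].

Definition H_irreducible : Prop :=
  (exists v : M, v != 0) /\
  forall P : M -> Prop, subspace P ->
    (forall i v, P v -> P (sg i v)) -> (forall k v, P v -> P (vs k v)) ->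
    (forall k v, P v -> P (y k v)) ->
    (forall v, P v -> v = 0) \/ (forall v, P v).

Local Notation Idx := {ffun 'I_L -> 'I_ka}.
Local Notation X := {ffun Idx -> M}.

Definition upd (a : Idx) (k : 'I_L) (j : 'I_ka) : Idx :=
  [ffun t => if t == k then j else a t].

(* E^{(k)}_{ij}: E_{ij} on the k-th tensor factor, with the Koszul sign
   (-1)^{(|i|+|j|)(|a_1|+...+|a_{k-1}|)} *)
Definition Ek (k : 'I_L) (i j : 'I_ka) (x : X) : X :=
  [ffun a : Idx => if a k == i then
     (-1) ^+ ((par i + par j) * (\sum_(t < L | (t < k)%N) par (a t)))%N
       *: x (upd a k j)
   else 0].

Definition liftM (f : M -> M) (x : X) : X := [ffun a : Idx => f (x a)].

Definition Gk (k : 'I_L) (x : X) : X := [ffun a : Idx => eps_ (a k) *: x a].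

Definition sigV (p q : 'I_L) (x : X) : X :=
  \sum_(a < ka) \sum_(b < ka) s_ b *: Ek p a b (Ek q b a x).

Definition sigX (i : 'I_l) (x : X) : X := liftM (sg i) (sigV (posL i) (posR i) x).
Definition vsX (x : X) : X := liftM (vs ord_max) (Gk ord_max x).

(* the subspace  sum_{i<L} Im(sigma_i - e) + Im(varsigma_L - e) *)
Definition contains_imgs (e : C) (P : X -> Prop) : Prop :=
  (forall i x, P (sigX i x - e *: x)) /\ (forall x, P (vsX x - e *: x)).
Definition Nsub (e : C) (x : X) : Prop :=
  forall P : X -> Prop, subspace P -> contains_imgs e P -> P x.

(* ----------- formal series in u^{-1} with values in End(X) (x) End(V) ---- *)
(* S r i j : coefficient of u^{-r} of the E_{ij} component *)
Definition Ser := nat -> 'I_ka -> 'I_ka -> X -> X.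

(* product in the super tensor product End(X) (x) End(V), for elements whose
   E_{ij}-coefficients have parity |i|+|j| (true for all factors below):
   (a (x) E_ij)(a' (x) E_jk) = (-1)^{(|i|+|j|)|a'|} a a' (x) E_ik *)
Definition smul (P Q : Ser) : Ser := fun r i k x =>
  \sum_(s < r.+1) \sum_(j < ka)
     (-1) ^+ ((par i + par j) * (par j + par k))%N *: P s i j (Q (r - s)%N j k x).

Definition oneS : Ser := fun r i j x => if (r == 0%N) && (i == j) then x else 0.

(* 1 + (u - a)^{-1} (x) Q^{(k)}, with (u-a)^{-1} = sum_{r>=0} a^r u^{-r-1},
   a an operator on M, Q^{(k)} = sum (-1)^{|i||j|+|i|+|j|} E^{(k)}_{ij} (x) E_{ij} *)
Definition geomQ (a : M -> M) (k : 'I_L) : Ser := fun r i j x =>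
  match r with
  | 0%N => if i == j then x else 0
  | r'.+1 => (-1) ^+ (par i * par j + par i + par j)%N *: liftM (iter r' a) (Ek k i j x)
  end.

Variables (gam chi : C).

Definition Tser (k : 'I_L) : Ser := geomQ (fun v => jmath *: v + chi *: y k v) k.
(* S_k(-u) = 1 - (-u + jmath - chi y_k)^{-1} (x) Q^{(k)}
           = 1 + (u - (jmath - chi y_k))^{-1} (x) Q^{(k)} *)
Definition Sser_neg (k : 'I_L) : Ser := geomQ (fun v => jmath *: v - chi *: y k v) k.
Definition Gser : Ser := fun r i j x =>
  if i == j then (match r with 0%N => eps_ i *: x | 1%N => gam *: x | _ => 0 end)
  else 0.

Definition Bser : Ser :=
  foldr smul oneS
    ([seq Tser k | k <- enum 'I_L] ++ Gser :: rev [seq Sser_neg k | k <- enum 'I_L]).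

(* action of the generator b_{ij}^{(r)}, r >= 1, read off from
   B(u) = sum (-1)^{|i||j|+|j|} b_ij(u) (x) E_ij *)
Definition bgen (i j : 'I_ka) (r : nat) (x : X) : X :=
  (-1) ^+ (par i * par j + par j)%N *: Bser r i j x.

Definition B_invariant (P : X -> Prop) : Prop :=
  forall i j r x, (0 < r)%N -> P x -> P (bgen i j r x).

(* D^e(M) is zero / D^e(M) is an irreducible B-module.  Submodules of the
   quotient X / N correspond to B-invariant subspaces P of X containing N;
   the submodule P/N is zero iff P is contained in N, and is everything iff
   P is all of X. *)
Definition Drinfeld_zero (e : C) : Prop := forall x : X, Nsub e x.

Definition Drinfeld_irreducible (e : C) : Prop :=
  ~ Drinfeld_zero e /\
  forall P : X -> Prop, subspace P -> (forall x, Nsub e x -> P x) -> B_invariant P ->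
    (forall x, P x -> Nsub e x) \/ (forall x, P x).

End Defs.

(* Main.v *)
Require Import Defs.
From HB Require Import structures.
From mathcomp Require Import all_boot all_order all_algebra.
From mathcomp Require Import complex reals.
From mathcomp Require Import perm zify.
From mathcomp Require boolp.
Set Implicit Arguments.
Unset Strict Implicit.
Unset Printing Implicit Defensive.
Import GRing.Theory Num.Theory.
Local Open Scope ring_scope.

(* Write X for M (x) V^{(x)L} and N for the subspace divided out. Symmetrizing
   over the Weyl group W gives e : X -> X with e x = x mod N, whose image
   consists of W-invariant vectors. For an invariant x <> 0, irreducibility of M
   and the matrix units of End(V^{(x)L}) give (H (x) End) x = X, and as W acts on
   x by scalars, X is spanned by the vectors w x with w a word in the operators
   y_k^r E^{(k)}_{ij}. So it suffices to show that a B-invariant P containing N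
   contains w x for every invariant x in P and every word w.

   This goes by induction on the degree of w in the y_k, then on its length.
   Modulo lower degree in the y_k, conjugation by W permutes the y_k and
   E^{(k)}_{ij} and changes signs, while the coefficient of u^{-r-1} E_{ij} in
   B(u) is a nonzero multiple of sum_k y_k^r E^{(k)}_{ij} plus a scalar as soon as
   eps_i eps_j = (-1)^r. Write w = w' y_p^r E^{(p)}_{ij}. If p occurs in w', two
   letters merge. Otherwise, if eps_i eps_j = (-1)^r, apply w' to e b x for this
   coefficient b: the terms k in w' merge, and the others are congruent to w x
   modulo P by permutation. If eps_i eps_j = -(-1)^r, the sign change at p gives
   w x = - w x modulo P. *)

(** * Symmetrizers *)

Section Linear.
Variables (R : realType) (U : lmodType R[i]).
Implicit Types (f : U -> U) (P : U -> Prop).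

Lemma is_lin0 f : is_lin f -> f 0 = 0.
Proof. by move=> fL; have := fL (-1) 0 0; rewrite scaler0 addr0 scaleN1r addNr. Qed.

Lemma is_linD f u v : is_lin f -> f (u + v) = f u + f v.
Proof. by move=> fL; have := fL 1 u v; rewrite !scale1r. Qed.

Lemma is_linZ f a u : is_lin f -> f (a *: u) = a *: f u.
Proof. by move=> fL; have := fL a u 0; rewrite (is_lin0 fL) !addr0. Qed.

Lemma is_linB f u v : is_lin f -> f (u - v) = f u - f v.
Proof. by move=> fL; rewrite is_linD // -[- v]scaleN1r is_linZ // scaleN1r. Qed.

Lemma is_lin_sum f (I : finType) (Q : pred I) (F : I -> U) : is_lin f ->
  f (\sum_(i | Q i) F i) = \sum_(i | Q i) f (F i).
Proof.
move=> fL; apply: (big_morph f) => [u v|]; first exact: is_linD.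
exact: is_lin0.
Qed.

Lemma is_lin_iter f r : is_lin f -> is_lin (iter r f).
Proof. by move=> fL; elim: r => [|r IHr] a u v //=; rewrite IHr fL. Qed.

Lemma subspaceD P u v : subspace P -> P u -> P v -> P (u + v).
Proof. by case=> _ PL Pu Pv; rewrite -[u]scale1r; apply: PL. Qed.

Lemma subspaceZ P a u : subspace P -> P u -> P (a *: u).
Proof. by case=> P0 PL Pu; rewrite -[_ *: _]addr0; apply: PL. Qed.

Lemma subspaceB P u v : subspace P -> P u -> P v -> P (u - v).
Proof. by case=> _ PL Pu Pv; rewrite addrC -scaleN1r; apply: PL. Qed.

Lemma subspace_sum P (I : finType) (Q : pred I) (F : I -> U) : subspace P ->
  (forall i, Q i -> P (F i)) -> P (\sum_(i | Q i) F i).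
Proof.
move=> PS PF; elim/big_ind: _ => // [|u v]; first by case: PS.
exact: subspaceD.
Qed.

Lemma subspace_trans P u v w :
  subspace P -> P (u - v) -> P (v - w) -> P (u - w).
Proof. by move=> PS uv vw; rewrite -(subrKA v); apply: subspaceD. Qed.

Lemma subspace_subr P u v : subspace P -> P (u - v) -> P v -> P u.
Proof. by move=> PS uv Pv; rewrite -(subrK v u); apply: subspaceD. Qed.

Lemma subspace_scalerI P a u : subspace P -> a != 0 -> P (a *: u) -> P u.
Proof. by move=> PS a0 /(subspaceZ a^-1 PS); rewrite scalerK. Qed.

End Linear.

(** * Averaging over the hyperoctahedral group *)

Section Symmetrizer.
Variables (R : realType) (X : lmodType R[i]) (l : nat).
Variables (t : 'I_l -> X -> X) (u : 'I_l.+1 -> X -> X).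
Hypotheses (tL : forall i, is_lin (t i)) (uL : forall k, is_lin (u k)).
Hypothesis tK : forall i, involutive (t i).
Hypothesis t_braid : forall (i j : 'I_l) v, val j = (val i).+1 ->
  t i (t j (t i v)) = t j (t i (t j v)).
Hypothesis t_far : forall (i j : 'I_l) v, ((val i).+1 < val j)%N ->
  t i (t j v) = t j (t i v).
Hypothesis uK : forall k, involutive (u k).
Hypothesis uC : forall k k' v, u k (u k' v) = u k' (u k v).
Hypothesis tu : forall i k v, t i (u k v) = u (swp i k) (t i v).

(** Natural-number indices leave the index arithmetic of the chains to [lia]; an index out of range
    acts as the identity. *)
Let tn (i : nat) (v : X) := if insub i is Some i' then t i' v else v.

Let tnE (i : 'I_l) v : tn i v = t i v.
Proof. by rewrite /tn valK. Qed.

Let tn_lt i (il : (i < l)%N) v : tn i v = t (Ordinal il) v.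
Proof. by rewrite -tnE. Qed.

(* [chain k p] is [t_{k-p+1} ... t_k]: the chains with [p <= k + 1] represent
   the cosets of the subgroup generated by [t_0, ..., t_{k-1}] in the one
   generated by [t_0, ..., t_k]. *)
Let chain k p := iteri p (fun q => tn (k - q)).

(** Every factor of the chain has index at least [i + 2], so far commutation suffices. *)
Let chain_low k p i v : (k < l)%N -> (i + p < k)%N ->
  tn i (chain k p v) = chain k p (tn i v).
Proof.
move=> kl; elim: p => [|p IHp] //= ipk; rewrite -IHp; last by lia.
have il : (i < l)%N by lia.
have kpl : (k - p < l)%N by lia.
rewrite !(tn_lt il) !(tn_lt kpl).
by rewrite t_far //=; lia.
Qed.

(** [t_i] commutes with the factors of index below [i - 1], the braid relation turns
    [t_i t_{i-1} t_i] into [t_{i-1} t_i t_{i-1}], and the new [t_{i-1}] commutes with the factors of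
    index above [i]. *)
Let chain_high k p i v : (k < l)%N -> (i <= k)%N -> (k.+1 < i + p)%N ->
  (p <= k.+1)%N -> tn i (chain k p v) = chain k p (tn i.-1 v).
Proof.
move=> kl ik; elim: p => [|p IHp]; first by lia.
move=> kip pk; case: (ltngtP k.+1 (i + p)) => [lt|lt|eq]; last 1 first.
- case: p IHp kip pk eq => [|p] IHp kip pk eq; first by lia.
  have il : (i < l)%N by lia.
  have i1l : (i.-1 < l)%N by lia.
  rewrite /= -/(chain k p) (_ : (k - p.+1)%N = i.-1); last by lia.
  rewrite (_ : (k - p)%N = i); last by lia.
  rewrite -(@chain_low k p i.-1 v kl); last by lia.
  rewrite !(tn_lt il) !(tn_lt i1l).
  by rewrite -t_braid //=; lia.
- rewrite /= -/(chain k p) -(IHp lt); last by lia.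
  have il : (i < l)%N by lia.
  have kpl : (k - p < l)%N by lia.
  rewrite !(tn_lt il) !(tn_lt kpl).
  by rewrite -t_far //=; lia.
- by lia.
Qed.

(** Left multiplication by [t_i] exchanges the chains of lengths [k - i] and [k - i + 1]. It passes
    through any other chain, becoming [t_i] or [t_{i-1}], which fixes [v]. *)
Let symm_step k v : (k < l)%N -> (forall i, (i < k)%N -> tn i v = v) ->
  forall i, (i <= k)%N ->
  tn i (\sum_(p < k.+2) chain k p v) = \sum_(p < k.+2) chain k p v.
Proof.
move=> kl vi i ik; have il : (i < l)%N by lia.
rewrite !(tn_lt il) is_lin_sum //.
have p1 : (k - i < k.+2)%N by lia.
have p2 : ((k - i).+1 < k.+2)%N by lia.
rewrite (reindex_inj (@perm_inj _ (tperm (Ordinal p1) (Ordinal p2)))) /=.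
apply: eq_bigr => p _; rewrite -(tn_lt il) /=.
case: tpermP => [->|->|/eqP p1' /eqP p2'] /=.
- by rewrite -/(chain k (k - i)) subKn // !(tn_lt il) tK.
- by rewrite subKn.
have lp := ltn_ord p.
have : ((i + p < k) || (k.+1 < i + p))%N.
  by move: p1' p2'; rewrite -!val_eqE /=; lia.
case/orP=> h; first by rewrite chain_low // vi //; lia.
by rewrite chain_high // ?vi //; lia.
Qed.

Let near_chain (U : X -> Prop) k p v : subspace U ->
  (forall i v, U v -> U (t i v)) ->
  (forall i, U (t i v - v)) -> U (chain k p v - v).
Proof.
move=> US Ut Uv; elim: p => [|p IHp] /=; first by rewrite subrr; case: US.
rewrite -/(chain k p) /tn; case: insub => // i.
apply: (subspace_trans US _ (Uv i)).
by rewrite -(is_linB _ _ (tL _)); apply: Ut.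
Qed.

(** The average over a symmetric group is built one generator at a time, by averaging over coset
    representatives. The congruence clause allows an arbitrary stable [U] because it is later used
    with several different ones. *)
Lemma permutation_symmetrizer : exists e : X -> X,
  (forall v i, t i (e v) = e v) /\
  forall U v, subspace U -> (forall i v, U v -> U (t i v)) ->
    (forall i, U (t i v - v)) -> U (e v - v).
Proof.
suff /(_ l (leqnn l)) [e [e1 e2]] : forall k, (k <= l)%N -> exists e : X -> X,
  (forall v i, (i < k)%N -> tn i (e v) = e v) /\
  forall U v, subspace U -> (forall i v, U v -> U (t i v)) ->
    (forall i, U (t i v - v)) -> U (e v - v).
  by exists e; split=> // v i; rewrite -tnE e1.
elim=> [_|k IHk kl].
  by exists id; split=> // U v US _ _; rewrite subrr; case: US.
have [e [e1 e2]] := IHk (ltnW kl).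
exists (fun v => k.+2%:R^-1 *: \sum_(p < k.+2) chain k p (e v)); split.
  move=> v i ik; have il : (i < l)%N by lia.
  rewrite !(tn_lt il) is_linZ // -(tn_lt il) symm_step //.
  exact: e1.
move=> U v US Ut Uv.
have k0 : k.+2%:R != 0 :> R[i] by rewrite pnatr_eq0.
apply: (subspace_scalerI US k0).
rewrite scalerBr scalerA divff // scale1r.
have -> : k.+2%:R *: v = \sum_(p < k.+2) v.
  by rewrite sumr_const card_ord scaler_nat.
rewrite -sumrB; apply: subspace_sum => // p _.
have Uev := e2 U v US Ut Uv.
apply: (subspace_trans US _ Uev).
apply: near_chain => // i.
have -> : t i (e v) - e v = t i (e v - v) + (t i v - v) - (e v - v).
  by rewrite (is_linB _ _ (tL i)) subrKA opprB subrKA.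
by apply: (subspaceB US) => //; apply: (subspaceD US) => //; apply: Ut.
Qed.

Let u_conj (i : 'I_l) v : u (posL i) v = t i (u (posR i) (t i v)).
Proof.
rewrite tu tK /swp; case: eqP => [/(congr1 val)/=|_]; first by rewrite /bump /=; lia.
by rewrite eqxx.
Qed.

(** The quotient and the cross relations with the [y_k] mention only the last sign change;
    conjugation by adjacent swaps carries a property of it to the other positions. *)
Lemma last_to_all (Q : 'I_l.+1 -> Prop) : Q ord_max ->
  (forall i : 'I_l, Q (posR i) -> Q (posL i)) -> forall k, Q k.
Proof.
move=> Qm QS k; have [p] : exists p, p = (l - k)%N by eexists.
elim: p k => [|p IHp] k kp; have lk := ltn_ord k.
  by rewrite (_ : k = ord_max) //; apply/val_inj => /=; lia.
have kl : (k < l)%N by lia.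
rewrite (_ : k = posL (Ordinal kl)); last exact/val_inj.
by apply: QS; apply: IHp; rewrite /= /bump /=; lia.
Qed.

Let sign_avg ks : X -> X :=
  foldr (fun k f v => 2%:R^-1 *: (f v + u k (f v))) id ks.

Let sign_avg_invariant ks k v : k \in ks -> u k (sign_avg ks v) = sign_avg ks v.
Proof.
elim: ks => [|k' ks IHks] //=; rewrite inE is_linZ // is_linD //.
have [-> _|_ /= /IHks kv] := eqVneq k k'; first by rewrite uK addrC.
by rewrite uC !kv.
Qed.

Lemma symmetrizer : exists e : X -> X,
  [/\ forall v i, t i (e v) = e v, forall v k, u k (e v) = e v &
  forall U v, subspace U -> (forall i v, U v -> U (t i v)) ->
    (forall v, U v -> U (u ord_max v)) ->
    (forall i, U (t i v - v)) -> U (u ord_max v - v) -> U (e v - v)].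
Proof.
have [e [e1 e2]] := permutation_symmetrizer.
exists (fun v => e (sign_avg (enum 'I_l.+1) v)); split=> [v i|v k|].
- exact: e1.
- set w := sign_avg _ v.
  have wu k' : u k' w = w by apply: sign_avg_invariant; rewrite mem_enum.
  (* The congruence clause [e2], applied to the space of vectors fixed by all sign changes, keeps
     the permutation average inside this space. *)
  pose U x := forall k', u k' x = x.
  have US : subspace U.
    split=> [k'|a x z Ux Uz k']; first exact: is_lin0.
    by rewrite uL Ux Uz.
  suff : U (e w) by [].
  have Ut i x : U x -> U (t i x).
    move=> Ux k'; rewrite -{2}(Ux (swp i k')) tu; congr u.
    rewrite /swp; case: (k' =P posL i) => [->|kl].
      by case: eqP => [->//|_]; rewrite eqxx.
    case: (k' =P posR i) => [->|kr]; first by rewrite eqxx.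
    by case: eqP => // _; case: eqP.
  apply: (subspace_subr US (v := w)) => //; apply: (e2 U) => // i.
  by apply: (subspaceB US) => //; apply: Ut.
- move=> U v US Ut Uu Utv Uuv.
  have Uu' : forall k x, U x -> U (u k x).
    apply: last_to_all => // i Ui x Ux.
    by rewrite u_conj; apply/Ut/Ui/Ut.
  have Uuv' : forall k, U (u k v - v).
    apply: last_to_all => // i Ui; rewrite u_conj.
    apply: (subspace_trans US (v := t i v)); last exact: Utv.
    rewrite -(is_linB _ _ (tL _)); apply: Ut.
    apply: (subspace_trans US (v := u (posR i) v)) => //.
    by rewrite -(is_linB _ _ (uL _)); apply: Uu'; apply: Utv.
  set w := sign_avg _ v.
  have Uw : U (w - v).
    rewrite /w; elim: (enum _) => [|k ks IHks] /=.
      by rewrite subrr; case: US.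
    apply: (subspace_scalerI US (a := 2%:R)); first by rewrite pnatr_eq0.
    rewrite scalerBr scalerA divff ?pnatr_eq0 // scale1r scaler_nat mulr2n.
    rewrite opprD addrACA; apply: (subspaceD US) => //.
    apply: (subspace_trans US (v := u k v)); last exact: Uuv'.
    by rewrite -(is_linB _ _ (uL _)); apply: Uu'.
  apply: (subspace_trans US (v := w)) => //; apply: (e2 U) => // i.
  have -> : t i w - w = t i (w - v) + (t i v - v) - (w - v).
    by rewrite (is_linB _ _ (tL i)) subrKA opprB subrKA.
  by apply: (subspaceB US) => //; apply: (subspaceD US) => //; apply: Ut.
Qed.

End Symmetrizer.

(** * Matrix units on tensor powers *)

Section AdjacentSwap.
Variable l : nat.
Implicit Types (i : 'I_l) (k : 'I_l.+1).

Lemma val_swp i k : val (swp i k) =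
  if val k == val i then (val i).+1 else if val k == (val i).+1 then val i else val k.
Proof. by rewrite /swp -!val_eqE /=; do 2?case: ifP. Qed.

Lemma posLR i : posL i != posR i.
Proof. by rewrite -val_eqE /= /bump /=; lia. Qed.

Lemma swpL i : swp i (posL i) = posR i.
Proof. by rewrite /swp eqxx. Qed.

Lemma swpR i : swp i (posR i) = posL i.
Proof. by rewrite /swp eq_sym (negPf (posLR i)) eqxx. Qed.

Lemma swpN i k : k != posL i -> k != posR i -> swp i k = k.
Proof. by rewrite /swp => /negPf-> /negPf->. Qed.

Lemma swpK i : involutive (swp i).
Proof. by move=> k; apply/val_inj; rewrite !val_swp /=; repeat case: eqP; lia. Qed.

Lemma swp_tperm i k : swp i k = tperm (posL i) (posR i) k.
Proof.
rewrite /swp; case: tpermP => [->|->|/eqP/negPf-> /eqP/negPf->] //.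
  by rewrite eqxx.
by rewrite eqxx eq_sym (negPf (posLR i)).
Qed.

Lemma swp_braid i j k : val j = (val i).+1 ->
  swp i (swp j (swp i k)) = swp j (swp i (swp j k)).
Proof. by move=> /= ji; apply/val_inj; rewrite !val_swp /=; repeat case: eqP; lia. Qed.

Lemma swp_far i j k : ((val i).+1 < val j)%N -> swp i (swp j k) = swp j (swp i k).
Proof. by move=> /= ji; apply/val_inj; rewrite !val_swp /=; repeat case: eqP; lia. Qed.

End AdjacentSwap.

(** * Signed matrix units, sign changes and swaps *)

Section TensorOperators.
Variables (R : realType) (m n : nat) (par epsb : 'I_(m + n) -> bool).
Variables (l : nat) (M : lmodType R[i]).
Local Notation C := R[i].
Local Notation ka := (m + n)%N.
Local Notation L := l.+1.
Local Notation Idx := {ffun 'I_L -> 'I_ka}.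
Local Notation X := {ffun Idx -> M}.
Local Notation E := (@Ek R m n par l M).
Local Notation G := (@Gk R m n epsb l M).
Local Notation eps := (eps_ R epsb).
Implicit Types (a c : Idx) (x z : X) (p q k : 'I_L) (g h : M -> M).

(** The Koszul sign depends on the preceding factors only through this boolean, so sign identities
    reduce to finite case analyses. *)
Definition prefix_parity a k : bool := odd (\sum_(t < L | (t < k)%N) par (a t)).

Definition swap_idx (i : 'I_l) a : Idx := [ffun t => a (swp i t)].

Lemma EkE k i j x a : E k i j x a =
  if a k == i then (-1) ^+ ((par i (+) par j) && prefix_parity a k) *: x (upd a k j)
  else 0.
Proof.
rewrite ffunE; case: ifP => // _; congr (_ *: _).
by rewrite -signr_odd oddM oddD !oddb.
Qed.

Lemma scale_funE (b : C) x a : (b *: x) a = b *: x a.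
Proof. by rewrite ffunE. Qed.

Lemma liftME g x a : liftM g x a = g (x a).
Proof. by rewrite ffunE. Qed.

Lemma GkE k x a : G k x a = eps (a k) *: x a.
Proof. by rewrite ffunE. Qed.

Lemma updE a k j t : upd a k j t = if t == k then j else a t.
Proof. by rewrite ffunE. Qed.

Lemma upd_upd a k i j : upd (upd a k i) k j = upd a k j.
Proof. by apply/ffunP=> t; rewrite !updE; case: (t == k). Qed.

Lemma updC a p q i j : p != q -> upd (upd a p i) q j = upd (upd a q j) p i.
Proof.
move=> pq; apply/ffunP=> t; rewrite !updE; case: eqP => // ->.
by rewrite eq_sym (negPf pq).
Qed.

Lemma upd_id a k : upd a k (a k) = a.
Proof. by apply/ffunP=> t; rewrite updE; case: eqP => // ->. Qed.

Lemma prefix_parity_upd a p j q : prefix_parity (upd a p j) q =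
  prefix_parity a q (+) ((p < q)%N && (par (a p) (+) par j)).
Proof.
rewrite /prefix_parity; case: (boolP (p < q)%N) => pq /=; last first.
  rewrite addbF; congr odd; apply: eq_bigr => t tq; rewrite updE.
  by case: eqP => // tp; rewrite -tp tq in pq.
rewrite !(bigD1 p pq) /= !oddD !oddb updE eqxx.
rewrite (_ : \sum_(t < L | _) _ = \sum_(t < L | (t < q)%N && (t != p)) par (a t))%N.
  by case: (par _); case: (par _); case: odd.
by apply: eq_bigr => t /andP[_ /negPf tp]; rewrite updE tp.
Qed.

Lemma prefix_parity_posR a i : prefix_parity a (posR i) =
  prefix_parity a (posL i) (+) par (a (posL i)).
Proof.
rewrite /prefix_parity (bigD1 (posL i)) /=; last by rewrite /bump /=; lia.
rewrite oddD oddb addbC; congr (odd _ (+) _); apply: eq_bigl => t.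
by rewrite -val_eqE /= /bump /=; lia.
Qed.

Lemma prefix_parity_swap i a k : k != posR i ->
  prefix_parity (swap_idx i a) k = prefix_parity a k.
Proof.
move=> kR; rewrite /prefix_parity (reindex_inj (can_inj (swpK i))) /=.
congr odd; apply: eq_big => t; last by move=> _; rewrite ffunE swpK.
have : val k <> i.+1 by move=> ki; case/eqP: kR; apply: val_inj.
by rewrite val_swp /=; repeat case: eqP; lia.
Qed.

Lemma Ek_lin k i j : is_lin (E k i j).
Proof.
move=> c u v; apply/ffunP=> a; rewrite !(EkE, ffunE); case: ifP => _.
  by rewrite scalerDr !scalerA mulrC.
by rewrite scaler0 addr0.
Qed.

Lemma Gk_lin k : is_lin (G k).
Proof.
by move=> c u v; apply/ffunP=> a; rewrite !ffunE scalerDr !scalerA mulrC.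
Qed.

Lemma liftM_lin g : is_lin g -> is_lin (liftM g : X -> X).
Proof. by move=> gL c u v; apply/ffunP=> a; rewrite !ffunE gL. Qed.

Lemma liftM_Ek g k i j x : is_lin g -> liftM g (E k i j x) = E k i j (liftM g x).
Proof.
move=> gL; apply/ffunP=> a; rewrite !(EkE, ffunE); case: ifP => _.
  by rewrite is_linZ.
by rewrite is_lin0.
Qed.

Lemma liftM_Gk g k x : is_lin g -> liftM g (G k x) = G k (liftM g x).
Proof. by move=> gL; apply/ffunP=> a; rewrite !ffunE is_linZ. Qed.

Lemma Ek_merge k i j i' j' x :
  E k i j (E k i' j' x) = (j == i')%:R *: E k i j' x.
Proof.
apply/ffunP=> a; rewrite !(EkE, scale_funE) updE eqxx prefix_parity_upd ltnn /= addbF.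
case: (a k =P i) => [<-|_]; last by rewrite scaler0.
case: eqP => [<-|_]; last by rewrite scaler0 scale0r.
rewrite scale1r upd_upd scalerA -signr_addb; congr ((-1) ^+ _ *: _).
by do 3!case: (par _); case: prefix_parity.
Qed.

(** The operator at [p] changes the parity in front of [q] by [|i| + |j|], which shows in the Koszul
    sign at [q]; the operator at [q] has no effect on the sign at [p]. *)
Lemma Ek_anticomm_lt p q i j i' j' x : (p < q)%N -> E p i j (E q i' j' x) =
  (-1) ^+ ((par i (+) par j) && (par i' (+) par j')) *: E q i' j' (E p i j x).
Proof.
move=> pq; have npq : p != q by rewrite -val_eqE /=; lia.
apply/ffunP=> a; rewrite !(EkE, scale_funE) !updE !prefix_parity_upd pq.
rewrite (eq_sym q) !(negPf npq) (leq_gtF (ltnW pq)) /= addbF.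
case: (a p =P i) => [ap|_]; last by case: ifP; rewrite ?scaler0.
case: (a q =P i') => [aq|_]; last by rewrite !scaler0.
rewrite (updC a j j' npq) !scalerA -!signr_addb.
congr ((-1) ^+ _ *: _); rewrite ap.
by do 4!case: (par _); do 2!case: prefix_parity.
Qed.

Lemma Ek_anticomm p q i j i' j' x : p != q -> E p i j (E q i' j' x) =
  (-1) ^+ ((par i (+) par j) && (par i' (+) par j')) *: E q i' j' (E p i j x).
Proof.
rewrite neq_ltn => /orP[pq|qp]; first exact: Ek_anticomm_lt.
by rewrite (Ek_anticomm_lt _ _ _ _ _ qp) scalerA andbC -signr_addb addbb scale1r.
Qed.

Lemma sum_Ek k x : \sum_i E k i i x = x.
Proof.
apply/ffunP=> a; rewrite sum_ffunE (bigD1 (a k)) //= EkE eqxx addbb /= scale1r.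
rewrite upd_id big1 ?addr0 // => i /negPf ik.
by rewrite EkE eq_sym ik.
Qed.

Lemma sum_eps_Ek k x : \sum_i eps i *: E k i i x = G k x.
Proof.
apply/ffunP=> a; rewrite sum_ffunE (bigD1 (a k)) //= scale_funE GkE EkE eqxx addbb /=.
rewrite scale1r upd_id big1 ?addr0 // => i /negPf ik.
by rewrite ffunE EkE eq_sym ik scaler0.
Qed.

Lemma eps_mul_self i : eps i * eps i = 1.
Proof. by rewrite /eps_ /sgnC -signr_addb addbb. Qed.

Lemma GkK k : involutive (G k).
Proof. by move=> x; apply/ffunP=> a; rewrite !ffunE scalerA eps_mul_self scale1r. Qed.

Lemma GkC p q x : G p (G q x) = G q (G p x).
Proof. by apply/ffunP=> a; rewrite !ffunE !scalerA mulrC. Qed.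

Lemma Gk_Ek p k i j x : G p (E k i j x) =
  (if k == p then eps i * eps j else 1) *: E k i j (G p x).
Proof.
apply/ffunP=> a; rewrite !(EkE, GkE, scale_funE) updE.
case: (a k =P i) => [ak|_]; last by rewrite !scaler0.
rewrite !scalerA [p == k]eq_sym; congr (_ *: _); case: eqP => [<-|_].
  by rewrite ak [RHS]mulrAC -[eps i * _ * _]mulrA eps_mul_self mulr1.
by rewrite mul1r mulrC.
Qed.

Local Notation S i := (@sigV R m n par l M (posL i) (posR i)).

Lemma swap_idxE i a t : swap_idx i a t = a (swp i t).
Proof. by rewrite ffunE. Qed.

(** One pair of indices survives in the double sum, and the Koszul signs combine with [s_b] into the
    sign of the super flip. The relations between swaps are read off from this form. *)
Lemma sigVE i x a : S i x a =
  (-1) ^+ (par (a (posL i)) && par (a (posR i))) *: x (swap_idx i a).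
Proof.
rewrite /sigV sum_ffunE (bigD1 (a (posL i))) //= [X in _ + X]big1 ?addr0; last first.
  move=> b /negPf bi; rewrite sum_ffunE big1 // => b' _.
  by rewrite scale_funE EkE [_ == b]eq_sym bi scaler0.
rewrite sum_ffunE (bigD1 (a (posR i))) //= [X in _ + X]big1 ?addr0; last first.
  move=> b /negPf bi; rewrite scale_funE EkE eqxx EkE updE [posR i == _]eq_sym.
  by rewrite (negPf (posLR i)) [a (posR i) == _]eq_sym bi !scaler0.
rewrite scale_funE EkE eqxx EkE updE [posR i == _]eq_sym (negPf (posLR i)) eqxx.
rewrite prefix_parity_upd prefix_parity_posR /=.
rewrite (_ : (i < bump 0 i)%N); last by rewrite /bump; lia.
rewrite !scalerA /s_ /sgnC -!signr_addb; congr (_ ^+ _ *: x _).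
  by case: (par _); case: (par _); case: prefix_parity.
apply/ffunP=> t; rewrite !updE ffunE /swp; case: (t =P posR i) => [->|_].
  by rewrite eq_sym (negPf (posLR i)).
by case: eqP.
Qed.

Lemma sigV_lin i : is_lin (S i).
Proof.
by move=> c u v; apply/ffunP=> a; rewrite !(sigVE, ffunE) scalerDr !scalerA mulrC.
Qed.

Lemma liftM_sigV g i x : is_lin g -> liftM g (S i x) = S i (liftM g x).
Proof. by move=> gL; apply/ffunP=> a; rewrite !(sigVE, liftME) is_linZ. Qed.

Lemma swap_idxK i : involutive (swap_idx i).
Proof. by move=> a; apply/ffunP=> t; rewrite !swap_idxE swpK. Qed.

Lemma swap_upd i a k j : swap_idx i (upd a (swp i k) j) = upd (swap_idx i a) k j.
Proof.
apply/ffunP=> t; rewrite !(swap_idxE, updE).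
by rewrite (can_eq (swpK i)).
Qed.

Lemma sigVK i : involutive (S i).
Proof.
move=> x; apply/ffunP=> a; rewrite !sigVE !swap_idxE swpL swpR swap_idxK scalerA.
by rewrite andbC -signr_addb addbb scale1r.
Qed.

Lemma sigV_far (i j : 'I_l) x : ((val i).+1 < val j)%N -> S i (S j x) = S j (S i x).
Proof.
move=> /= ij; apply/ffunP=> a; rewrite !sigVE !swap_idxE !scalerA mulrC.
rewrite !(swpN (i := i)); try by rewrite -val_eqE /= /bump /=; lia.
rewrite !(swpN (i := j)); try by rewrite -val_eqE /= /bump /=; lia.
by congr (_ *: x _); apply/ffunP=> t; rewrite !swap_idxE swp_far.
Qed.

Lemma sigV_braid (i j : 'I_l) x : val j = (val i).+1 ->
  S i (S j (S i x)) = S j (S i (S j x)).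
Proof.
move=> /= ij; apply/ffunP=> a; rewrite !sigVE !swap_idxE !scalerA -!signr_addb.
have jL : posL j = posR i by apply/val_inj => /=; rewrite /bump /= ij.
have iR : swp i (posR j) = posR j.
  by apply/val_inj; rewrite val_swp /= /bump /=; repeat case: eqP; lia.
have jR : swp j (posL i) = posL i.
  by apply/val_inj; rewrite val_swp /=; repeat case: eqP; lia.
have iLj : swp i (posL j) = posL i by rewrite jL swpR.
have iLL : swp i (posL i) = posL j by rewrite jL swpL.
rewrite -!jL !(iLj, iLL, iR, jR, swpR, (swpL j)) .
congr ((-1) ^+ _ *: x _); last first.
  by apply/ffunP=> t; rewrite !swap_idxE swp_braid.
by do 3!case: (par _).
Qed.

(** If [k] is a swapped position, the change in the flip sign cancels the change in prefix parity.
    At any other position neither changes. *)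
Lemma sigV_Ek i k b b' x : S i (E k b b' x) = E (swp i k) b b' (S i x).
Proof.
apply/ffunP=> a; rewrite !(sigVE, EkE) swap_idxE.
case: (a (swp i k) =P b) => [ak|_]; last by rewrite scaler0.
rewrite swap_upd !scalerA -!signr_addb; congr ((-1) ^+ _ *: x _).
rewrite !updE.
have [kL|kL] := eqVneq k (posL i).
  rewrite kL swpL in ak *; rewrite eqxx (negPf (posLR i)) ak.
  rewrite prefix_parity_swap ?posLR // prefix_parity_posR.
  by do 3!case: (par _); case: prefix_parity.
have [kR|kR] := eqVneq k (posR i).
  rewrite kR swpR in ak *; rewrite eqxx eq_sym (negPf (posLR i)) ak.
  rewrite prefix_parity_posR prefix_parity_swap ?posLR // swap_idxE swpL.
  by do 3!case: (par _); case: prefix_parity.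
rewrite swpN // prefix_parity_swap // !(eq_sym _ k) (negPf kL) (negPf kR).
by rewrite addbC.
Qed.

Lemma sigV_Gk i k x : S i (G k x) = G (swp i k) (S i x).
Proof.
by apply/ffunP=> a; rewrite !(sigVE, GkE) swap_idxE !scalerA mulrC.
Qed.

Definition single a (v : M) : X := [ffun c => if c == a then v else 0].

Lemma sum_single x : x = \sum_a single a (x a).
Proof.
apply/ffunP=> c; rewrite sum_ffunE (bigD1 c) //= ffunE eqxx big1 ?addr0 // => a.
by rewrite ffunE eq_sym => /negPf->.
Qed.

Lemma single_lin a (b : C) u v : single a (b *: u + v) = b *: single a u + single a v.
Proof.
by apply/ffunP=> c; rewrite !ffunE; case: ifP; rewrite // scaler0 addr0.
Qed.

Lemma liftM_single g a v : is_lin g -> liftM g (single a v) = single a (g v).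
Proof.
by move=> gL; apply/ffunP=> c; rewrite !ffunE; case: ifP; rewrite // is_lin0.
Qed.

(** Recording the existence of the sign is enough, since subspaces absorb nonzero scalars. *)
Lemma Ek_single k j a v : exists s : bool,
  E k (a k) j (single (upd a k j) v) = (-1) ^+ s *: single a v.
Proof.
exists ((par (a k) (+) par j) && prefix_parity a k).
apply/ffunP=> c; rewrite !(EkE, ffunE).
have [->|ca] := eqVneq c a; first by rewrite eqxx eqxx.
rewrite scaler0; case: eqP => // ck; case: eqP => [e|_]; last by rewrite scaler0.
case/eqP: ca; apply/ffunP=> t; have [->//|tk] := eqVneq t k.
by have := congr1 (fun f : Idx => f t) e; rewrite !updE (negPf tk).
Qed.

Lemma sigV_single i a v : exists s : bool,
  S i (single (swap_idx i a) v) = (-1) ^+ s *: single a v.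
Proof.
exists (par (a (posL i)) && par (a (posR i))).
apply/ffunP=> c; rewrite !(sigVE, ffunE) (can_eq (swap_idxK i)).
by case: eqP => [->//|_]; rewrite !scaler0.
Qed.

Lemma Gk_single k a v : G k (single a v) = eps (a k) *: single a v.
Proof.
by apply/ffunP=> c; rewrite !ffunE; case: eqP => [->//|_]; rewrite !scaler0.
Qed.

End TensorOperators.

(** * Words filtered by their degree in the [y_k] *)

Section Words.
Variables (R : realType) (m n : nat) (par epsb : 'I_(m + n) -> bool).
Variables (l : nat) (M : lmodType R[i]) (y : 'I_l.+1 -> M -> M).
Local Notation C := R[i].
Local Notation ka := (m + n)%N.
Local Notation L := l.+1.
Local Notation Idx := {ffun 'I_L -> 'I_ka}.
Local Notation X := {ffun Idx -> M}.
Local Notation E := (@Ek R m n par l M).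
Local Notation G := (@Gk R m n epsb l M).
Local Notation S i := (@sigV R m n par l M (posL i) (posR i)).
Local Notation Y k r := (@liftM R m n l M (iter r (y k))).
Local Notation eps := (eps_ R epsb).
Hypothesis yL : forall k, is_lin (y k).
Hypothesis yC : forall k k' v, y k (y k' v) = y k' (y k v).

(* The letter [(k, r, (i, j))] stands for the operator [y_k^r E^{(k)}_{ij}]. *)
Definition letter : Type := 'I_L * nat * ('I_ka * 'I_ka).
Implicit Types (x : X) (z : letter) (w : seq letter) (k : 'I_L) (f g : X -> X).

Definition lpos z := z.1.1.
Definition ldeg z := z.1.2.
Definition lop z x := Y (lpos z) (ldeg z) (E (lpos z) z.2.1 z.2.2 x).
Definition wop w x := foldr lop x w.
Definition wdeg w := sumn (map ldeg w).

(** The bound is strict, so the error term of a statement in degree [d] lies in [filt d], and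
    [filt 0] contains only the zero operator. Closure under pointwise equality is built in to avoid
    function extensionality. *)
Inductive filt (d : nat) : (X -> X) -> Prop :=
| filt_word w : (wdeg w < d)%N -> filt d (wop w)
| filt_zero : filt d (fun=> 0)
| filt_comb a f g : filt d f -> filt d g -> filt d (fun x => a *: f x + g x)
| filt_ext f g : f =1 g -> filt d f -> filt d g.

Lemma liftM_comp (h h' : M -> M) x : liftM h (liftM h' x) = liftM (h \o h') x.
Proof. by apply/ffunP=> a; rewrite !liftME. Qed.

Lemma eq_liftM (h h' : M -> M) x : h =1 h' -> liftM h x = liftM h' x.
Proof. by move=> hh; apply/ffunP=> a; rewrite !liftME hh. Qed.

Lemma Y_lin k r : is_lin (Y k r).
Proof. exact/liftM_lin/is_lin_iter. Qed.

Lemma Y_Ek k r k' i j x : Y k r (E k' i j x) = E k' i j (Y k r x).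
Proof. exact/liftM_Ek/is_lin_iter. Qed.

Lemma YD k r r' x : Y k r (Y k r' x) = Y k (r + r') x.
Proof. by rewrite liftM_comp; apply: eq_liftM => v /=; rewrite iterD. Qed.

Lemma YC k k' r r' x : Y k r (Y k' r' x) = Y k' r' (Y k r x).
Proof.
rewrite !liftM_comp; apply: eq_liftM => v /=.
elim: r => [|r IHr] //=; rewrite {}IHr.
by elim: r' => [|r' IHr'] //=; rewrite yC IHr'.
Qed.

Lemma lop_lin z : is_lin (lop z).
Proof. by move=> a u v; rewrite /lop Ek_lin Y_lin. Qed.

Lemma wop_lin w : is_lin (wop w).
Proof. by elim: w => [|z w IHw] a u v //=; rewrite IHw lop_lin. Qed.

Lemma wop_cat w w' x : wop (w ++ w') x = wop w (wop w' x).
Proof. by rewrite /wop foldr_cat. Qed.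

Lemma wdeg_cat w w' : wdeg (w ++ w') = (wdeg w + wdeg w')%N.
Proof. by rewrite /wdeg map_cat sumn_cat. Qed.

Lemma filt_is_lin d f : filt d f -> is_lin f.
Proof.
elim=> {f} [w _|a u v|b f g _ fL _ gL a u v|f g fg _ fL a u v].
- exact: wop_lin.
- by rewrite scaler0 addr0.
- by rewrite fL gL !scalerDr !scalerA mulrC addrACA.
- by rewrite -!fg.
Qed.

Lemma filt_mono d e f : (d <= e)%N -> filt d f -> filt e f.
Proof.
move=> de; elim=> {f} [w dw||a f g _ ff _ fg|f g fg _ ff].
- by apply: filt_word; apply: leq_trans de.
- exact: filt_zero.
- exact: filt_comb.
- exact: filt_ext ff.
Qed.

Lemma filt_scale d a f : filt d f -> filt d (fun x => a *: f x).
Proof.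
move=> ff; apply: filt_ext (filt_comb a ff (filt_zero d)) => x.
by rewrite addr0.
Qed.

Lemma filt_add d f g : filt d f -> filt d g -> filt d (fun x => f x + g x).
Proof.
by move=> ff fg; apply: filt_ext (filt_comb 1 ff fg) => x; rewrite scale1r.
Qed.

Lemma filt_sum d (I : finType) (F : I -> X -> X) :
  (forall i, filt d (F i)) -> filt d (fun x => \sum_i F i x).
Proof.
move=> FF; elim: (index_enum I) => [|i s IHs].
  by apply: filt_ext (filt_zero d) => x; rewrite big_nil.
by apply: filt_ext (filt_add (FF i) IHs) => x; rewrite big_cons.
Qed.

(** Degrees at most [d - 1] and [d' - 1] add up to at most [d + d' - 2], hence the bound [e.+1]. *)
Lemma filt_comp d d' e f g : (d + d' <= e.+1)%N ->
  filt d f -> filt d' g -> filt e (f \o g).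
Proof.
move=> de ff fg; elim: ff => {f} [w dw||a f h _ ff _ fh|f h fh _ ff].
- elim: fg => {g} [w' dw'||a f g _ ff _ fg|f g fg _ ff].
  + apply: filt_ext (filt_word (w := w ++ w') _) => [x|].
      by rewrite wop_cat.
    by rewrite wdeg_cat; lia.
  + apply: filt_ext (filt_zero e) => x /=; rewrite is_lin0 //; exact: wop_lin.
  + by apply: filt_ext (filt_comb a ff fg) => x /=; rewrite wop_lin.
  + by apply: filt_ext ff => x /=; rewrite fg.
- exact: filt_zero.
- exact: filt_comb ff fh.
- by apply: filt_ext ff => x /=; rewrite fh.
Qed.

Lemma filt_letter z : filt (ldeg z).+1 (lop z).
Proof.
apply: filt_ext (filt_word (w := [:: z]) _) => //.
by rewrite /wdeg /= addn0.
Qed.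

Lemma filt_id : filt 1 id.
Proof. exact: filt_ext (filt_word (w := [::]) _). Qed.

Lemma filt_Ek k i j : filt 1 (E k i j).
Proof.
apply: filt_ext (filt_letter (k, 0%N, (i, j))) => x; rewrite /lop /=.
by apply/ffunP=> a; rewrite liftME.
Qed.

(** A bare power of [y_k] is not a letter, but it is the sum of the letters with diagonal matrix
    units, which add up to the identity. *)
Lemma filt_Y k r : filt r.+1 (Y k r).
Proof.
have FF i : filt r.+1 (lop (k, r, (i, i))) by exact: (filt_letter (k, r, (i, i))).
apply: filt_ext (filt_sum FF) => x.
rewrite /lop /= -(is_lin_sum _ _ (Y_lin k r)) sum_Ek //.
Qed.

Lemma filt_Gk k : filt 1 (G k).
Proof.
apply: filt_ext (filt_sum (fun i => filt_scale (eps i) (filt_Ek k i i))) => x.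
exact: sum_eps_Ek.
Qed.

Lemma filt_sigV p q : filt 1 (@sigV R m n par l M p q).
Proof.
do 2!(apply: filt_sum => ?); apply: filt_scale.
exact: (@filt_comp 1 1 1 (E p _ _) (E q _ _) _ (filt_Ek _ _ _) (filt_Ek _ _ _)).
Qed.

Lemma lop_merge z z' x : lpos z = lpos z' -> lop z (lop z' x) =
  (z.2.2 == z'.2.1)%:R *: lop (lpos z, ldeg z + ldeg z', (z.2.1, z'.2.2))%N x.
Proof.
rewrite /lop /lpos /ldeg /= => <-.
by rewrite -Y_Ek Ek_merge YD (is_linZ _ _ (Y_lin _ _)).
Qed.

Lemma lop_comm z z' : lpos z != lpos z' ->
  exists c : C, forall x, lop z (lop z' x) = c *: lop z' (lop z x).
Proof.
move=> zz'; exists ((-1) ^+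
  ((par z.2.1 (+) par z.2.2) && (par z'.2.1 (+) par z'.2.2))) => x.
rewrite /lop -!Y_Ek YC Ek_anticomm //.
by rewrite !(is_linZ _ _ (Y_lin _ _)).
Qed.

Lemma wop_comm z w : lpos z \notin map lpos w ->
  exists c : C, forall x, wop w (lop z x) = c *: lop z (wop w x).
Proof.
elim: w => [|z' w IHw]; first by exists 1 => x; rewrite scale1r.
rewrite /= inE negb_or eq_sym => /andP[/lop_comm[c cP] /IHw[c' c'P]].
by exists (c' * c) => x; rewrite c'P (is_linZ _ _ (@lop_lin _)) cP scalerA.
Qed.

(** The letter moves left, up to a scalar, past letters at other positions until it meets the
    rightmost letter at its own position and merges with it. If the inner matrix indices differ, the
    scalar is 0. *)
Lemma wop_merge z w : lpos z \in map lpos w -> exists (c : C) w',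
  [/\ size w' = size w, wdeg w' = (wdeg w + ldeg z)%N &
      forall x, wop w (lop z x) = c *: wop w' x].
Proof.
elim: w => [|z' w IHw] //=; rewrite inE.
case: (boolP (lpos z \in map lpos w)) => [/IHw[c [w' [sw' dw' w'P]]] _|zw].
  exists c, (z' :: w'); split=> [|| x]; first by rewrite /= sw'.
    by rewrite /wdeg /= -!/(wdeg _) dw' addnA.
  by rewrite w'P (is_linZ _ _ (@lop_lin _)).
rewrite orbF => /eqP zz'; have [c cP] := wop_comm zw.
exists (c * (z'.2.2 == z.2.1)%:R),
  ((lpos z', ldeg z' + ldeg z, (z'.2.1, z.2.2))%N :: w); split=> // [|x].
  by rewrite /wdeg /= addnAC.
by rewrite cP (is_linZ _ _ (@lop_lin _)) lop_merge // scalerA.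
Qed.

(** * Moving a Weyl group generator past a word *)

Section Conjugation.
Variables (s : M -> M) (A : X -> X) (b : C) (phi : 'I_L -> 'I_L).
Variables (c c' : 'I_L -> C) (d : 'I_L -> 'I_ka -> 'I_ka -> C).
Hypotheses (sL : is_lin s) (fA : filt 1 A).
Hypothesis liftA : forall h x, is_lin h -> liftM h (A x) = A (liftM h x).
Hypothesis s_y : forall k v, s (y k v) = c k *: y (phi k) (s v) + c' k *: v.
Hypothesis A_Ek : forall k i j x, A (E k i j x) = d k i j *: E (phi k) i j (A x).

(** This covers both kinds of generators: an adjacent swap, with [phi = swp i] and [c = 1], and the
    last sign change, with [phi] the identity and [c = -1] at the last position. The scalars of the
    Hecke cross relations are in [c']. *)
Definition twist x := b *: liftM s (A x).
Definition lmap z : letter := (phi (lpos z), ldeg z, z.2).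
Definition lsign z := c (lpos z) ^+ ldeg z * d (lpos z) z.2.1 z.2.2.

Lemma twist_lin : is_lin twist.
Proof.
move=> a u v; rewrite /twist (filt_is_lin fA) (liftM_lin sL).
by rewrite scalerDr !scalerA mulrC.
Qed.

Lemma twist_Y r k : exists f, filt r f /\ forall x,
  twist (Y k r x) = c k ^+ r *: Y (phi k) r (twist x) + f x.
Proof.
elim: r => [|r [f [ff fP]]].
  exists (fun=> 0); split=> [|x]; first exact: filt_zero.
  rewrite scale1r addr0; have Y0 k' x' : Y k' 0 x' = x'.
    by apply/ffunP=> a; rewrite liftME.
  by rewrite !Y0.
(* The scalar term of [s_y] consumes [s] but leaves [A], which is harmless because [A] has degree
   zero in the [y_k]. *)
exists (fun x => c k *: Y (phi k) 1 (f x) + (b * c' k) *: A (Y k r x)); split.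
  apply: filt_add; apply: filt_scale.
    by apply: (filt_comp (f := Y (phi k) 1) _ (filt_Y _ 1) ff); lia.
  by apply: (filt_comp _ fA (filt_Y k r)); lia.
move=> x; rewrite -(YD k 1 r) exprS -scalerA -(YD (phi k) 1 r).
rewrite addrA -scalerDr -(is_linZ _ _ (Y_lin _ _)) -(is_linD _ _ (Y_lin _ _)) -fP.
rewrite /twist -liftA; last exact: yL.
rewrite (is_linZ b _ (Y_lin _ _)) scalerA mulrC -!scalerA -scalerDr; congr (_ *: _).
by apply/ffunP=> a; rewrite !(liftME, scale_funE, ffunE) s_y.
Qed.

Lemma twist_lop z : exists f, filt (ldeg z) f /\ forall x,
  twist (lop z x) = lsign z *: lop (lmap z) (twist x) + f x.
Proof.
have [f [ff fP]] := twist_Y (ldeg z) (lpos z).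
exists (f \o E (lpos z) z.2.1 z.2.2); split.
  by apply: (filt_comp _ ff (filt_Ek _ _ _)); lia.
move=> x; rewrite /lop fP /= /lsign; congr (_ + _).
rewrite -scalerA; congr (_ *: _); rewrite /twist A_Ek.
rewrite (is_linZ _ _ (liftM_lin sL)) liftM_Ek // scalerA mulrC -scalerA.
by rewrite !(is_linZ _ _ (Ek_lin _ _ _ _)) !(is_linZ _ _ (Y_lin _ _)).
Qed.

Lemma twist_wop w : exists f, filt (wdeg w) f /\ forall x, twist (wop w x) =
  (\prod_(z <- w) lsign z) *: wop (map lmap w) (twist x) + f x.
Proof.
elim: w => [|z w [g [fg gP]]].
  exists (fun=> 0); split=> [|x]; first exact: filt_zero.
  by rewrite big_nil scale1r addr0.
have [f [ff fP]] := twist_lop z.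
exists (fun x => lsign z *: lop (lmap z) (g x) + f (wop w x)); split.
  apply: filt_add; last first.
    apply: (filt_comp (g := wop w) _ ff (filt_word (ltnSn _))).
    by rewrite /wdeg /=; lia.
  apply: filt_scale; apply: (filt_comp _ (filt_letter (lmap z)) fg).
  exact: leqnn.
move=> x; rewrite /= fP gP big_cons (is_linD _ _ (lop_lin _)) scalerDr -addrA.
by rewrite (is_linZ _ _ (lop_lin _)) scalerA.
Qed.

Lemma wdeg_lmap w : wdeg (map lmap w) = wdeg w.
Proof. by rewrite /wdeg -map_comp. Qed.

(** A fixed vector absorbs the [twist] that reaches it, so its translates by operators in [filt e]
    form a [twist]-stable space. *)
Lemma twist_filt e f : filt e f ->
  exists g, filt e g /\ forall x, twist x = x -> twist (f x) = g x.
Proof.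
elim=> {f} [w dw||a f f' _ [g [fg gP]] _ [g' [fg' gP']]|f f' ff' _ [g [fg gP]]].
- have [g [fg gP]] := twist_wop w.
  exists (fun x => (\prod_(z <- w) lsign z) *: wop (map lmap w) x + g x); split.
    apply: filt_comb; last exact: filt_mono (ltnW dw) fg.
    by apply: filt_word; rewrite wdeg_lmap.
  by move=> x tx; rewrite gP tx.
- exists (fun=> 0); split=> [|x _]; first exact: filt_zero.
  by rewrite is_lin0 //; exact: twist_lin.
- exists (fun x => a *: g x + g' x); split=> [|x tx]; first exact: filt_comb.
  by rewrite twist_lin gP ?gP'.
- by exists g; split=> // x tx; rewrite -ff' gP.
Qed.

End Conjugation.

(** * Leading terms of operator-valued series *)

Local Notation smul := (@smul R m n par l M).

(* Up to terms of lower degree in the [y_k] and a scalar, the coefficient of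
   [u^{-r-1}] of the series [P] is [sum_k d r i j k y_k^r E^{(k)}_{ij}]. *)
Definition leading (c : 'I_ka -> C) (d : nat -> 'I_ka -> 'I_ka -> 'I_L -> C)
    (P : @Ser R m n l M) : Prop :=
  (forall i j x, P 0 i j x = (if i == j then c i else 0) *: x) /\
  forall r i j, exists (g : C) f, filt r f /\ forall x, P r.+1 i j x =
    \sum_k d r i j k *: lop (k, r, (i, j)) x + (g *: x + f x).

Lemma leading_filt c d P r i j : leading c d P -> (0 < r)%N -> filt r (P r i j).
Proof.
case=> _ Pr; case: r => // r _; have [g [f [ff fP]]] := Pr r i j.
have fL : filt r.+1 (fun x => \sum_k d r i j k *: lop (k, r, (i, j)) x).
  by apply: filt_sum => k; apply: filt_scale; apply: (filt_letter (k, r, (i, j))).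
have fI : filt r.+1 (fun x => g *: x) by apply: filt_scale; apply: filt_mono filt_id.
apply: filt_ext (filt_add fL (filt_add fI (filt_mono (leqnSn r) ff))) => x.
by rewrite fP.
Qed.

(** Constant coefficients are diagonal scalars, and the coefficient of [u^{-s}] has degree at most
    [s - 1]. So top degree comes only from the two extreme terms of the Cauchy product; the interior
    terms, collected in [f0], lose a degree. *)
Lemma leading_mul c d P c' d' P' : leading c d P -> leading c' d' P' ->
  leading (fun i => c i * c' i) (fun r i j k => c i * d' r i j k + c' j * d r i j k)
    (smul P P').
Proof.
move=> lP lP'; have [[P0 Pr] [P'0 P'r]] := (lP, lP').
have sgn0 (a b : nat) : (-1) ^+ ((a + a) * b)%N = 1 :> C.
  by rewrite addnn -signr_odd oddM odd_double.
split=> [i k x|r i k].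
  rewrite /smul big_ord1 (bigD1 i) //= big1 => [|j /negPf ij]; last first.
    by rewrite P0 eq_sym ij scale0r scaler0.
  rewrite P0 P'0 eqxx addr0 sgn0 scale1r scalerA.
  by case: eqP; rewrite ?mulr0.
have [g [f [ff fP]]] := Pr r i k; have [g' [f' [ff' fP']]] := P'r r i k.
pose f0 x := \sum_(s < r) \sum_j
  (-1) ^+ ((par i + par j) * (par j + par k))%N *: P s.+1 i j (P' (r - s)%N j k x).
have ff0 : filt r f0.
  do 2!(apply: filt_sum => ?); apply: filt_scale.
  apply: (filt_comp _ (leading_filt _ _ lP _) (leading_filt _ _ lP' _)) => //.
    by rewrite addSn subnKC // ltnW.
  by rewrite subn_gt0.
exists (c i * g' + c' k * g), (fun x => c i *: f' x + (c' k *: f x + f0 x)); split.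
  by do !apply: filt_add => //; apply: filt_scale.
move=> x; rewrite /smul big_ord_recl big_ord_recr /= subn0 subnn.
rewrite (_ : \sum_j _ = c i *: P' r.+1 i k x); last first.
  rewrite (bigD1 i) //= big1 => [|j /negPf ij]; last first.
    by rewrite P0 eq_sym ij scale0r scaler0.
  by rewrite P0 eqxx addr0 sgn0 scale1r.
rewrite [X in _ + (_ + X) = _](_ : _ = c' k *: P r.+1 i k x); last first.
  have PL j : is_lin (P r.+1 i j) by apply: filt_is_lin (leading_filt i j lP _).
  rewrite (bigD1 k) //= big1 => [|j /negPf ij]; last first.
    by rewrite P'0 ij scale0r is_lin0 // scaler0.
  rewrite P'0 eqxx addr0 mulnC sgn0 scale1r.
  exact: is_linZ.
rewrite [X in _ + (X + _)](_ : _ = f0 x) // fP fP'.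
have -> : \sum_q (c i * d' r i k q + c' k * d r i k q) *: lop (q, r, (i, k)) x =
    c i *: (\sum_q d' r i k q *: lop (q, r, (i, k)) x) +
    c' k *: (\sum_q d r i k q *: lop (q, r, (i, k)) x).
  rewrite !scaler_sumr -big_split; apply: eq_bigr => q _ /=.
  by rewrite scalerDl !scalerA.
rewrite !scalerDr !scalerA scalerDl.
by rewrite [LHS](AC ((1*2)*(1*(1*2))) ((1*5)*((2*6)*(3*(7*4))))).
Qed.

Lemma leading_one : leading (fun=> 1) (fun _ _ _ _ => 0) (@oneS R m n l M).
Proof.
split=> [i j x|r i j]; first by rewrite /oneS /=; case: eqP; rewrite ?scale1r ?scale0r.
exists 0, (fun=> 0); split=> [|x]; first exact: filt_zero.
by rewrite /oneS /= big1 ?scale0r ?addr0 // => k _; rewrite scale0r.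
Qed.

Lemma leading_Gser gam : leading eps (fun _ _ _ _ => 0) (@Gser R m n epsb l M gam).
Proof.
split=> [i j x|r i j]; first by rewrite /Gser /=; case: eqP; rewrite ?scale0r.
exists (if (i == j) && (r == 0%N) then gam else 0), (fun=> 0).
split=> [|x]; first exact: filt_zero.
rewrite big1 => [|k _]; last by rewrite scale0r.
by rewrite add0r addr0 /Gser; case: eqP; case: r => [|r]; rewrite /= ?scale0r.
Qed.

Lemma leading_geomQ (a : M -> M) (b c : C) q : (forall v, a v = b *: v + c *: y q v) ->
  leading (fun=> 1)
    (fun r i j k => (k == q)%:R * ((-1) ^+ (par i * par j + par i + par j)%N * c ^+ r))
    (geomQ par a q).
Proof.
move=> aE; have aL : is_lin a.
  move=> t u v; rewrite !aE yL !scalerDr !scalerA mulrC (mulrC c).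
  by rewrite addrACA.
have [f fP] : exists f : nat -> X -> X, forall r, filt r (f r) /\ forall x,
    liftM (iter r a) x = c ^+ r *: Y q r x + f r x.
  (* Expand [a^{r+1} = (b + c y_q) a^r], inserting [a^r = c^r y_q^r + f_r] only after [c y_q]. *)
  pose f := fix f r := if r is r'.+1 then
    fun x => b *: liftM (iter r' a) x + c *: Y q 1 (f r' x) else fun=> 0.
  exists f; elim=> [|r [ff fP]].
    split=> [|x]; first exact: filt_zero.
    by rewrite scale1r addr0; apply/ffunP=> t; rewrite !liftME.
  have fa : filt r.+1 (liftM (iter r a)).
    have fY := filt_scale (c ^+ r) (filt_Y q r).
    apply: filt_ext (filt_add fY (filt_mono (leqnSn r) ff)) => x.
    by rewrite fP.
  split=> [|x].
    apply: filt_add; apply: filt_scale => //.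
    by apply: (filt_comp _ (filt_Y q 1) ff); lia.
  rewrite /= addrCA exprS -scalerA -(YD q 1) -scalerDr.
  rewrite -(is_linZ _ _ (Y_lin _ _)) -(is_linD _ _ (Y_lin _ _)) -fP.
  by apply/ffunP=> t; rewrite !(liftME, ffunE) /= aE.
split=> [i j x|r i j]; first by rewrite /=; case: eqP; rewrite ?scale1r ?scale0r.
have [ff {}fP] := fP r.
exists 0, (fun x => (-1) ^+ (par i * par j + par i + par j)%N *: f r (E q i j x)).
split=> [|x].
  by apply: filt_scale; apply: (filt_comp _ ff (filt_Ek q i j)); rewrite addn1.
rewrite scale0r add0r (bigD1 q) //= big1 => [|k /negPf kq]; last first.
  by rewrite kq mul0r scale0r.
by rewrite eqxx mul1r addr0 fP scalerDr scalerA.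
Qed.

End Words.

Arguments lpos {m n l} z.
Arguments ldeg {m n l} z.
Arguments wdeg {m n l} w.

(** * The Drinfeld functor *)

(** Induction on the distance: the transposition of [p] and [q] is that of [p + 1] and [q],
    conjugated by the adjacent swap at [p]. *)
Lemma tperm_of_swp l (Q : ('I_l.+1 -> 'I_l.+1) -> Prop) :
  (forall f g, f =1 g -> Q f -> Q g) -> (forall f g, Q f -> Q g -> Q (f \o g)) ->
  Q id -> (forall i : 'I_l, Q (swp i)) -> forall p q, Q (tperm p q).
Proof.
move=> Qe Qc Q1 Qs.
have lt_case d (p q : 'I_l.+1) : val q = (p + d).+1 -> Q (tperm p q).
  elim: d p => [|d IHd] p qp; have lq := ltn_ord q.
    have pl : (p < l)%N by rewrite /= in qp; lia.
    apply: Qe (Qs (Ordinal pl)) => k; rewrite swp_tperm.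
    have -> : posL (Ordinal pl) = p by apply: val_inj.
    by have -> : posR (Ordinal pl) = q by apply: val_inj; rewrite qp /= /bump; lia.
  have pl : (p < l)%N by rewrite /= in qp; lia.
  set i := Ordinal pl.
  have iL : posL i = p by apply: val_inj.
  have iR : val (posR i) = p.+1 by rewrite /= /bump; lia.
  have Qi : Q (tperm (posR i) q) by apply: IHd; rewrite iR qp addSnnS.
  apply: Qe (Qc _ _ (Qs i) (Qc _ _ Qi (Qs i))) => k /=.
  rewrite !swp_tperm -iL; set L := posL i; set R := posR i.
  have nLq : L != q by apply/eqP=> /(congr1 val) /=; rewrite qp; lia.
  have nRq : R != q by apply/eqP=> /(congr1 val); rewrite iR qp; lia.
  have <- : (tperm R q ^ tperm L R = tperm L q)%g by rewrite tpermJ tpermR tpermD.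
  by rewrite /conjg tpermV !permM.
move=> p q; case: (ltngtP p q) => [pq|qp|pq].
- by apply: (lt_case (q - p.+1)%N) => /=; lia.
- by rewrite tpermC; apply: (lt_case (p - q.+1)%N) => /=; lia.
- by apply: Qe Q1 => k; rewrite (val_inj pq) tperm1 perm1.
Qed.

Section DrinfeldModule.
Variables (R : realType) (m n : nat) (par epsb : 'I_(m + n) -> bool).
Variables (l : nat) (M : lmodType R[i]).
Variables (sg : 'I_l -> M -> M) (vs y : 'I_l.+1 -> M -> M).
Variables (th1 th2 gam chi : R[i]) (epsilon : bool).
Hypothesis HM : is_Hmodule sg vs y th1 th2.
Local Notation C := R[i].
Local Notation ka := (m + n)%N.
Local Notation L := l.+1.
Local Notation Idx := {ffun 'I_L -> 'I_ka}.
Local Notation X := {ffun Idx -> M}.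
Local Notation E := (@Ek R m n par l M).
Local Notation G := (@Gk R m n epsb l M).
Local Notation S i := (@sigV R m n par l M (posL i) (posR i)).
Local Notation eps := (eps_ R epsb).
Local Notation e0 := (sgnC R epsilon).
Local Notation B := (@Bser R m n par epsb l M y gam chi).
Local Notation letter := (letter m n l).
Local Notation lop := (@lop R m n par l M y).
Local Notation wop := (@wop R m n par l M y).
Local Notation filt := (@filt R m n par l M y).
Implicit Types (x : X) (z : letter) (w : seq letter) (k : 'I_L).

Let sgL i : is_lin (sg i). Proof. by case: HM => -[]. Qed.
Let vsL k : is_lin (vs k). Proof. by case: HM => -[]. Qed.
Let yL k : is_lin (y k). Proof. by case: HM => -[]. Qed.
Let sgK i : involutive (sg i). Proof. by move=> v; case: HM => _ []. Qed.
Let vsK k : involutive (vs k). Proof. by move=> v; case: HM => _ []. Qed.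
Let yC k k' v : y k (y k' v) = y k' (y k v).
Proof. by case: HM => _ _ _ []. Qed.

Let e0K : e0 * e0 = 1.
Proof. by rewrite /sgnC -signr_addb addbb. Qed.

Let sgn_factor (i j : 'I_ka) : C := (-1) ^+ (par i * par j + par i + par j)%N.

Lemma leading_eq c d c' d' (P : @Ser R m n l M) :
  (forall i, c i = c' i) -> (forall r i j k, d r i j k = d' r i j k) ->
  leading par y c d P -> leading par y c' d' P.
Proof.
move=> cc dd [P0 Pr]; split=> [i j x|r i j]; first by rewrite P0 cc.
have [g [f [ff fP]]] := Pr r i j; exists g, f; split=> // x.
by rewrite fP; congr (_ + _); apply: eq_bigr => k _; rewrite dd.
Qed.

(** The factors [T_k] stand to the left of [G] and pick up [eps j]; the factors [S_k] stand to its
    right and pick up [eps i]. Each position occurs once on either side, so the coefficient does not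
    depend on the position. *)
Lemma leading_Bser : leading par y eps
  (fun r i j _ => sgn_factor i j * (chi ^+ r * eps j + (- chi) ^+ r * eps i)) B.
Proof.
have lT k := leading_geomQ par yL (a := fun v => jmath R m n *: v + chi *: y k v)
  (fun=> erefl).
have lS k := leading_geomQ par yL (a := fun v => jmath R m n *: v - chi *: y k v)
  (b := jmath R m n) (c := - chi) (q := k) (fun v => ltac:(by rewrite scaleNr)).
have lSs ks : leading par y (fun=> 1)
    (fun r i j k => (count_mem k ks)%:R * (sgn_factor i j * (- chi) ^+ r))
    (foldr (@smul R m n par l M) (@oneS R m n l M)
      [seq @Sser_neg R m n par l M y chi k | k <- ks]).
  elim: ks => [|k ks IHks].
    by apply: leading_eq (leading_one par y) => // r i j k; rewrite mul0r.
  apply: leading_eq (leading_mul yL (lS k) IHks) => [i|r i j q]; first by rewrite mul1r.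
  by rewrite !mul1r /= natrD mulrDl addrC [k == q]eq_sym.
(* Arbitrary lists make the induction possible; the multiplicities become 1 for [enum]. *)
have lB ks ks' : leading par y eps
    (fun r i j k => sgn_factor i j * ((count_mem k ks)%:R * (chi ^+ r * eps j) +
      (count_mem k ks')%:R * ((- chi) ^+ r * eps i)))
    (foldr (@smul R m n par l M) (@oneS R m n l M)
      ([seq @Tser R m n par l M y chi k | k <- ks] ++ @Gser R m n epsb l M gam ::
       [seq @Sser_neg R m n par l M y chi k | k <- ks'])).
  elim: ks => [|k ks IHks] /=.
    have lG := leading_Gser par epsb y gam.
    apply: leading_eq (leading_mul yL lG (lSs ks')) => [i|r i j q].
      by rewrite mulr1.
    rewrite mulr0 addr0 mul0r add0r mulrC -!mulrA; rewrite [RHS]mulrCA.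
    by congr (_ * _); rewrite !mulrA.
  apply: leading_eq (leading_mul yL (lT k) IHks) => [i|r i j q]; first by rewrite mul1r.
  rewrite mul1r /= natrD !mulrDl !mulrDr [k == q]eq_sym addrC !addrA.
  congr (_ + _ + _); first by rewrite mulrC !mulrA [_ * sgn_factor i j]mulrC.
rewrite /Bser -map_rev; apply: leading_eq (lB _ _) => // r i j k.
by rewrite count_rev !count_uniq_mem ?enum_uniq // mem_enum !mul1r.
Qed.


(** * The Weyl group action and its invariant vectors *)

Let sg_y i k v : sg i (y k v) = 1 *: y (swp i k) (sg i v) +
  (if k == posL i then th1 else if k == posR i then - th1 else 0) *: v.
Proof.
case: HM => _ _ _ [_ sgy _ _ sgyC]; rewrite scale1r.
have [->|kL] := eqVneq k (posL i); first by rewrite swpL -(sgy i) addrC subrK.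
have [->|kR] := eqVneq k (posR i); last by rewrite swpN // scale0r addr0 sgyC.
(* The relation at [posR i] is the one at [posL i], conjugated by [sg i]. *)
rewrite swpR; have /(congr1 (sg i)) := sgy i (sg i v).
rewrite (is_linB _ _ (sgL i)) (is_linZ _ _ (sgL i)) !sgK => e.
by rewrite scaleNr -e opprB addrC subrK.
Qed.

Let vs_y k v : vs ord_max (y k v) =
  (if k == ord_max then -1 else 1) *: y k (vs ord_max v) +
  (if k == ord_max then th2 else 0) *: v.
Proof.
case: HM => _ _ _ [_ _ vsy vsyL _].
have [->|kL] := eqVneq k ord_max; first by rewrite -vsyL scaleN1r addrC addrK.
by rewrite vsy // scale1r scale0r addr0.
Qed.

(** As [e0] squares to 1, absorbing it keeps the Weyl group relations and turns the relations of the
    quotient into invariance. *)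
Let t i : X -> X := twist (sg i) (S i) e0.
Let u k : X -> X := twist (vs k) (G k) e0.

Let tL i : is_lin (t i).
Proof. exact: (twist_lin yL e0 (sgL i) (filt_sigV par yL _ _)). Qed.
Let uL k : is_lin (u k).
Proof. exact: (twist_lin yL e0 (vsL k) (filt_Gk par epsb y k)). Qed.

Let twist2 (s s' : M -> M) (A A' : X -> X) x : is_lin s -> is_lin s' -> is_lin A ->
  (forall x', liftM s' (A x') = A (liftM s' x')) ->
  twist s A e0 (twist s' A' e0 x) = liftM s (liftM s' (A (A' x))).
Proof.
move=> sL s'L AL As; rewrite /twist (is_linZ _ _ AL) (is_linZ _ _ (liftM_lin sL)).
by rewrite scalerA e0K scale1r -As.
Qed.

Let liftM_sg i j x : liftM (sg i) (S j x) = S j (liftM (sg i) x).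
Proof. exact: liftM_sigV. Qed.

Let tt i j x : t i (t j x) = liftM (sg i) (liftM (sg j) (S i (S j x))).
Proof. by apply: twist2 => //; apply: sigV_lin. Qed.

Let tK i : involutive (t i).
Proof.
move=> x; rewrite tt sigVK; apply/ffunP=> a; rewrite !liftME; exact: sgK.
Qed.

Let t_far (i j : 'I_l) x : ((val i).+1 < val j)%N -> t i (t j x) = t j (t i x).
Proof.
move=> ij; rewrite !tt sigV_far //; apply/ffunP=> a; rewrite !liftME.
by case: HM => _ [_ _ far _ _] _ _; apply: far.
Qed.

Let t_braid (i j : 'I_l) x : val j = (val i).+1 ->
  t i (t j (t i x)) = t j (t i (t j x)).
Proof.
move=> ij; rewrite [t j (t i x)]tt [t i (t j x)]tt /t /twist !liftM_sg.
rewrite -!liftM_sg sigV_braid //; congr (_ *: _); apply/ffunP=> a; rewrite !liftME.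
by case: HM => _ [_ br _ _ _] _ _; apply: br.
Qed.

Let uu k k' x : u k (u k' x) = liftM (vs k) (liftM (vs k') (G k (G k' x))).
Proof. by apply: twist2 => // [|z]; [apply: Gk_lin|apply: liftM_Gk]. Qed.

Let uK k : involutive (u k).
Proof. move=> x; rewrite uu GkK; apply/ffunP=> a; rewrite !liftME; exact: vsK. Qed.

Let uC k k' x : u k (u k' x) = u k' (u k x).
Proof.
rewrite !uu GkC; apply/ffunP=> a; rewrite !liftME.
by case: HM => _ [_ _ _ _ vsC] _ _; apply: vsC.
Qed.

Let tu i k x : t i (u k x) = u (swp i k) (t i x).
Proof.
rewrite /t /u twist2 //; [|exact: sigV_lin|by move=> z; apply: liftM_sigV].
rewrite twist2 //; [|exact: Gk_lin|by move=> z; apply: liftM_Gk].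
rewrite sigV_Gk; apply/ffunP=> a; rewrite !liftME.
by case: HM => _ _ sgvs _; apply: sgvs.
Qed.

Let tmap i z : letter := lmap (swp i) z.

Let t_wop i w : exists f, filt (wdeg w) f /\
  forall x, t i (wop w x) = wop (map (tmap i) w) (t i x) + f x.
Proof.
have A_Ek k a b x : S i (E k a b x) = 1 *: E (swp i k) a b (S i x).
  by rewrite scale1r sigV_Ek.
have [f [ff fP]] := twist_wop yL e0 (sgL i) (filt_sigV par yL _ _)
  (fun h x hL => liftM_sigV par i x hL) (sg_y i) A_Ek w.
exists f; split=> // x; rewrite /t fP; congr (_ + _).
by rewrite big1 ?scale1r // => z _; rewrite /lsign expr1n mulr1.
Qed.

Let t_filt d i f : filt d f -> exists g, filt d g /\
  forall x, t i x = x -> t i (f x) = g x.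
Proof.
have A_Ek k a b x : S i (E k a b x) = 1 *: E (swp i k) a b (S i x).
  by rewrite scale1r sigV_Ek.
exact: (twist_filt yL e0 (sgL i) (filt_sigV par yL _ _)
  (fun h x hL => liftM_sigV par i x hL) (sg_y i) A_Ek).
Qed.

(** The last [y] changes sign modulo a scalar, once per power; conjugation by [G] contributes the
    two [eps]. *)
Let usign z : C := if lpos z == ord_max then
  (-1) ^+ ldeg z * (eps z.2.1 * eps z.2.2) else 1.

Let u_wop w : exists f, filt (wdeg w) f /\ forall x,
  u ord_max (wop w x) = (\prod_(z <- w) usign z) *: wop w (u ord_max x) + f x.
Proof.
have [f [ff fP]] := twist_wop yL e0 (vsL _) (filt_Gk par epsb y _)
  (fun h x hL => liftM_Gk epsb _ x hL) vs_y (Gk_Ek par epsb ord_max) w.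
exists f; split=> // x; rewrite /u fP; congr (_ *: wop _ _ + _).
  apply: eq_bigr => z _; rewrite /lsign /usign.
  by case: eqP => // _; rewrite expr1n mul1r.
by rewrite -[RHS]map_id; apply: eq_map => -[[k r] ij].
Qed.

Let u_filt d f : filt d f -> exists g, filt d g /\
  forall x, u ord_max x = x -> u ord_max (f x) = g x.
Proof.
exact: (twist_filt yL e0 (vsL _) (filt_Gk par epsb y _)
  (fun h x hL => liftM_Gk epsb _ x hL) vs_y (Gk_Ek par epsb ord_max)).
Qed.

Let invariant x := (forall i, t i x = x) /\ (forall k, u k x = x).

(* The translates of an invariant vector by operators of degree [< d]. *)
Let span d x (v : X) := exists f, filt d f /\ v = f x.

Let span_subspace d x : subspace (span d x).
Proof.
split=> [|a v w [f [ff ->]] [g [fg ->]]].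
  by exists (fun=> 0); split=> //; apply: filt_zero.
by exists (fun x' => a *: f x' + g x'); split=> //; apply: filt_comb.
Qed.

Let span_t d x i v : invariant x -> span d x v -> span d x (t i v).
Proof.
move=> [xt _] [f [ff ->]]; have [g [fg gP]] := t_filt i ff.
by exists g; split=> //; rewrite gP.
Qed.

Let span_u d x v : invariant x -> span d x v -> span d x (u ord_max v).
Proof.
move=> [_ xu] [f [ff ->]]; have [g [fg gP]] := u_filt ff.
by exists g; split=> //; rewrite gP.
Qed.

(** * A nonzero invariant vector generates the whole space *)

Hypothesis Hirr : H_irreducible sg vs y.

Let orbit (x v : X) := exists d, span d x v.

Let orbit_subspace x : subspace (orbit x).
Proof.
split=> [|a v v' [d sv] [d' sv']].
  by exists 0%N; case: (span_subspace 0 x).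
have up e f : (e <= f)%N -> forall v0, span e x v0 -> span f x v0.
  by move=> ef v0 [g [fg ->]]; exists g; split=> //; apply: filt_mono fg.
exists (maxn d d'); case: (span_subspace (maxn d d') x) => _; apply.
  exact: up (leq_maxl _ _) _ sv.
exact: up (leq_maxr _ _) _ sv'.
Qed.

Let orbit_filt d f x v : filt d f -> orbit x v -> orbit x (f v).
Proof.
move=> ff [d' [g [fg ->]]]; exists (d + d')%N, (f \o g); split=> //.
by apply: (filt_comp yL _ ff fg).
Qed.

(** The product of the units [E_{a_k a_k}] over all positions [k] projects onto the component
    [a]. *)
Let orbit_single x a : orbit x (single a (x a)).
Proof.
pose w (ks : seq 'I_L) : seq letter := [seq (k, 0%N, (a k, a k)) | k <- ks].
have wE ks c : wop (w ks) x c = if all (fun k => c k == a k) ks then x c else 0.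
  elim: ks c => [|k ks IHks] c //=; rewrite /lop /= liftME EkE addbb /= scale1r.
  by case: eqP => // <-; rewrite upd_id IHks.
exists (wdeg (w (enum 'I_L))).+1, (wop (w (enum 'I_L))).
split; first exact: filt_word.
apply/ffunP=> c; rewrite wE ffunE; case: eqP => [->|ca].
  by rewrite (_ : all _ _) //; apply/allP.
case: allP => // e1; case: ca; apply/ffunP=> k; apply/eqP/e1; exact: mem_enum.
Qed.

Let orbit_upd x b k j v : orbit x (single b v) -> orbit x (single (upd b k j) v).
Proof.
move=> bv; have [s] := Ek_single par k (b k) (upd b k j) v.
rewrite upd_upd upd_id => e1.
have := orbit_filt (filt_Ek par y k (upd b k j k) (b k)) bv; rewrite e1.
by apply: (subspace_scalerI (orbit_subspace x)); rewrite signr_eq0.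
Qed.

Let orbit_single_all x a b v : orbit x (single b v) -> orbit x (single a v).
Proof.
move=> bv; have : orbit x (single (foldr (fun k c => upd c k (a k)) b (enum 'I_L)) v).
  by elim: (enum _) => [|k ks IHks] //=; apply: orbit_upd.
suff -> : foldr (fun k c => upd c k (a k)) b (enum 'I_L) = a by [].
apply/ffunP=> k; have : k \in enum 'I_L by rewrite mem_enum.
elim: (enum _) => [|k' ks IHks] //=; rewrite inE updE.
by case: eqP => [->|_ /IHks].
Qed.

Let orbit_full x : invariant x -> x != 0 -> forall v, orbit x v.
Proof.
move=> [xt xu] x0; have xI : invariant x by [].
have OS := orbit_subspace x.
have ot i v : orbit x v -> orbit x (t i v).
  by move=> [d sv]; exists d; apply: span_t.
have ou v : orbit x v -> orbit x (u ord_max v).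
  by move=> [d sv]; exists d; apply: span_u.
(* [Q] is a Hecke submodule of [M]: it inherits stability from the orbit because swaps and sign
   changes act on basis tensors by signed permutations. It contains all components of [x], so
   irreducibility forces [Q] to be [M]. *)
pose Q v := forall a, orbit x (single a v).
have [_ Hsub] := Hirr.
have QS : subspace Q.
  split=> [a|a v v' Qv Qv' b].
    have -> : single a 0 = 0 :> X by apply/ffunP=> c; rewrite !ffunE if_same.
    by case: OS.
  by rewrite single_lin; case: OS => _; apply.
have Qsg i v : Q v -> Q (sg i v).
  move=> Qv a; have [s e1] := sigV_single par i a v.
  apply: (subspace_scalerI OS (a := e0 * (-1) ^+ s)).
    by rewrite mulf_neq0 ?signr_eq0.
  have := ot i _ (Qv (swap_idx i a)); rewrite /t /twist e1.
  by rewrite (is_linZ _ _ (liftM_lin (sgL i))) liftM_single // scalerA.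
have Qvs : forall k v, Q v -> Q (vs k v).
  apply: last_to_all => [v Qv a|i Qi v Qv].
    apply: (subspace_scalerI OS (a := e0 * eps (a ord_max))).
      by rewrite mulf_neq0 ?signr_eq0.
    have := ou _ (Qv a); rewrite /u /twist Gk_single.
    by rewrite (is_linZ _ _ (liftM_lin (vsL _))) liftM_single // scalerA.
  have sgvs : sg i (vs (posR i) (sg i v)) = vs (posL i) v.
    by case: HM => _ _ -> _; rewrite swpR sgK.
  by rewrite -sgvs; apply/Qsg/Qi/Qsg.
have Qy k v : Q v -> Q (y k v).
  by move=> Qv a; rewrite -liftM_single //; apply: (orbit_filt (filt_Y par yL k 1)).
case: (Hsub Q QS Qsg Qvs Qy) => [Q0|QT v].
  case/eqP: x0; apply/ffunP=> a; rewrite ffunE; apply: Q0 => b.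
  exact: orbit_single_all (orbit_single x a).
by rewrite (sum_single v); apply: subspace_sum => // a _; apply: QT.
Qed.

Local Notation N := (@Nsub R m n par epsb l M sg vs e0).

Let N_t i x : N (t i x - x).
Proof.
move=> Q QS [Qs _]; have := subspaceZ e0 QS (Qs i x).
by rewrite scalerBr scalerA e0K scale1r.
Qed.

Let N_u x : N (u ord_max x - x).
Proof.
move=> Q QS [_ Qu]; have := subspaceZ e0 QS (Qu x).
by rewrite scalerBr scalerA e0K scale1r.
Qed.

(** * Invariant subspaces containing [N] *)

Section Submodule.
Variable P : X -> Prop.
Hypotheses (PS : subspace P) (chi0 : chi != 0).
Hypothesis PN : forall x, N x -> P x.
Hypothesis PB : @B_invariant R m n par epsb l M y gam chi P.

Let P_t i x : P (t i x - x).
Proof. by apply: PN; apply: N_t. Qed.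

Let P_u x : P (u ord_max x - x).
Proof. by apply: PN; apply: N_u. Qed.

Let P_Bser r i j x : P x -> P (B r.+1 i j x).
Proof.
move=> Px; have := PB i j (ltn0Sn r) Px; rewrite /bgen.
by apply: subspace_scalerI => //; rewrite signr_eq0.
Qed.

Variable e : X -> X.
Hypothesis e_inv : forall v, invariant (e v).
Hypothesis e_near : forall U v, subspace U -> (forall i v, U v -> U (t i v)) ->
    (forall v, U v -> U (u ord_max v)) ->
    (forall i, U (t i v - v)) -> U (u ord_max v - v) -> U (e v - v).

Let P_e x : P (e x - x).
Proof.
apply: e_near => // [i v Pv|v Pv].
- exact: subspace_subr (P_t i v) Pv.
- exact: subspace_subr (P_u v) Pv.
Qed.

Let words_sum r i j x : X := \sum_k lop (k, r, (i, j)) x.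

(** Modulo lower degree, [t q] only permutes the summands. *)
Let words_sum_t r i j q x : invariant x ->
  span r x (t q (words_sum r i j x) - words_sum r i j x).
Proof.
move=> [xt xu]; rewrite {2}/words_sum (reindex_inj (can_inj (swpK q))) /=.
rewrite is_lin_sum // -sumrB; apply: subspace_sum => [|k _]; first exact: span_subspace.
have [f [ff fP]] := t_wop q [:: (k, r, (i, j))].
exists f; split; first by move: ff; rewrite /wdeg /= addn0.
by have /= -> := fP x; rewrite xt addrC addKr.
Qed.

(** The condition on [eps] makes the sign picked up at the last position equal to 1. *)
Let words_sum_u r i j x : invariant x -> eps i * eps j = (-1) ^+ r ->
  span r x (u ord_max (words_sum r i j x) - words_sum r i j x).
Proof.
move=> [xt xu] ij; rewrite /words_sum is_lin_sum // -sumrB.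
apply: subspace_sum => [|k _]; first exact: span_subspace.
have [f [ff fP]] := u_wop [:: (k, r, (i, j))].
exists f; split; first by move: ff; rewrite /wdeg /= addn0.
have /= -> := fP x; rewrite xu big_seq1 /usign /= ij -expr2 sqrr_sign if_same.
by rewrite scale1r addrC addKr.
Qed.

(* Symmetrizing [B r.+1 i j x] gives an invariant vector of [P] with a known
   leading term. *)
Let leading_vector r i j x : P x -> invariant x -> eps i * eps j = (-1) ^+ r ->
  exists x1, [/\ P x1, invariant x1 & exists (c g : C),
    c != 0 /\ span r x (x1 - (c *: words_sum r i j x + g *: x))].
Proof.
move=> Px xI ij; set v := B r.+1 i j x.
have Pv : P v by apply: P_Bser.
exists (e v); split=> //; first exact: subspace_subr (P_e v) Pv.
have [_ /(_ r i j)[g [f [ff fP]]]] := leading_Bser.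
set c := sgn_factor i j * (chi ^+ r * eps j + (- chi) ^+ r * eps i) in fP.
exists c, g; split.
  (* By [ij], the term with [- chi] equals the one with [chi], so the two add instead of
     cancelling. *)
  have -> : c = sgn_factor i j * (chi ^+ r * eps j *+ 2).
    rewrite /c exprNn -ij mulr2n; congr (_ * (_ + _)).
    by rewrite mulrAC [eps i * _]mulrC -[eps j * _ * _]mulrA eps_mul_self mulr1 mulrC.
  rewrite !mulf_neq0 ?signr_eq0 // -mulr_natr !mulf_neq0 ?pnatr_eq0 //.
    exact: expf_neq0.
  by rewrite /eps_ /sgnC signr_eq0.
set S0 := words_sum r i j x.
have vE : v - (c *: S0 + g *: x) = f x.
  by rewrite /v fP /S0 /words_sum scaler_sumr addrA [_ + f x]addrC addrK.
have US := span_subspace r x.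
apply: (subspace_trans US (v := v)); last by exists f.
have tv (tau : X -> X) : is_lin tau -> tau x = x ->
    (forall x', span r x x' -> span r x (tau x')) ->
    span r x (tau S0 - S0) -> span r x (tau v - v).
  move=> tauL tx taus tS.
  have -> : v = f x + (c *: S0 + g *: x) by rewrite -vE subrK.
  rewrite (is_linD _ _ tauL) opprD addrACA; apply: (subspaceD US).
    by apply: (subspaceB US); [apply: taus|]; exists f.
  rewrite tauL (is_linZ _ _ tauL) tx opprD addrACA subrr addr0 -scalerBr.
  exact: subspaceZ.
(* Here the stable subspace is [span r x], so symmetrizing preserves the leading term. *)
apply: e_near => // [q z|z|q|].
- exact: span_t.
- exact: span_u.
- apply: tv => // [|z|]; [by case: xI|exact: span_t|exact: words_sum_t].
- apply: tv => // [|z|]; [by case: xI|exact: span_u|exact: words_sum_u].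
Qed.

(** * The inductive step on degree and length *)

Section Induction.
Variables (d s : nat).
Hypothesis lower_deg : forall w x, (wdeg w < d)%N -> P x -> invariant x ->
  P (wop w x).
Hypothesis shorter : forall w x, wdeg w = d -> (size w < s)%N -> P x ->
  invariant x -> P (wop w x).

Let P_filt f x : filt d f -> P x -> invariant x -> P (f x).
Proof.
move=> ff Px xI; elim: ff => {f} [w wd||a f g _ Pf _ Pg|f g fg _ Pf].
- exact: lower_deg.
- by case: PS.
- by case: PS => _; apply.
- by rewrite -fg.
Qed.

Let P_short w x : (wdeg w <= d)%N -> (size w < s)%N -> P x -> invariant x ->
  P (wop w x).
Proof.
rewrite leq_eqVlt => /orP[/eqP wd|wd] ws Px xI; first exact: shorter.
exact: lower_deg.
Qed.

(** Applying [t i] to [wop w x] changes it only within [P], while moving [t i] through the word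
    renames positions up to lower degree. Adjacent swaps then generate all transpositions. *)
Let P_tperm w x p q : wdeg w = d -> P x -> invariant x ->
  P (wop (map (lmap (tperm p q)) w) x - wop w x).
Proof.
move=> wd Px xI.
pose Q (phi : 'I_L -> 'I_L) := forall w, wdeg w = d ->
  P (wop (map (lmap phi) w) x - wop w x).
suff : Q (tperm p q) by apply.
apply: (tperm_of_swp (Q := Q)) => [phi psi e1 Qp v vd|phi psi Qf Qg v vd|v vd|i v vd].
- rewrite -(eq_map (f := lmap phi)) => [|z]; first exact: Qp.
  by rewrite /lmap e1.
- rewrite (_ : map _ v = map (lmap phi) (map (lmap psi) v)); last by rewrite -map_comp.
  apply: (subspace_trans PS (v := wop (map (lmap psi) v) x)); last exact: Qg.
  by apply: Qf; rewrite wdeg_lmap.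
- rewrite (_ : map _ v = v) ?subrr; first by case: PS.
  by rewrite -[RHS]map_id; apply: eq_map => -[[k r] ij].
have [f [ff fP]] := t_wop i v.
have -> : wop (map (lmap (swp i)) v) x = t i (wop v x) - f x.
  by rewrite fP; case: xI => -> _; rewrite addrK.
rewrite addrAC; apply: (subspaceB PS); first exact: P_t.
by apply: P_filt => //; rewrite -vd.
Qed.

Let P_merge w z x : lpos z \in map lpos w -> (wdeg w + ldeg z)%N = d ->
  (size w < s)%N -> P x -> invariant x -> P (wop w (lop z x)).
Proof.
move=> zw wd ws Px xI; have [c [w' [sw' dw' ->]]] := wop_merge par yL yC zw.
apply: (subspaceZ _ PS); apply: P_short => //; first by rewrite dw' wd.
by rewrite sw'.
Qed.

(** After the position of [z] is renamed to the last one, [z] is the only letter there. The last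
    sign change then negates the word modulo [P], so twice the word lies in [P]. *)
Let P_wop_parity w z x : lpos z \notin map lpos w -> (wdeg w + ldeg z)%N = d ->
  eps z.2.1 * eps z.2.2 != (-1) ^+ ldeg z ->
  P x -> invariant x -> P (wop w (lop z x)).
Proof.
move=> zw wd ij Px xI; set w1 := rcons w z.
have dw1 : wdeg w1 = d by rewrite /w1 -cats1 wdeg_cat /wdeg /= addn0.
have -> : wop w (lop z x) = wop w1 x by rewrite /w1 -cats1 wop_cat.
have ijN : eps z.2.1 * eps z.2.2 = - (-1) ^+ ldeg z.
  move: ij; rewrite /eps_ /sgnC -signr_addb -(signr_odd _ (ldeg z)).
  by case: (_ (+) _); case: odd; rewrite ?opprK ?eqxx.
have := P_tperm (lpos z) ord_max dw1 Px xI; set w2 := map _ w1 => P21.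
have dw2 : wdeg w2 = d by rewrite wdeg_lmap.
suff P2 : P (wop w2 x).
  by have := subspaceB PS P2 P21; rewrite opprB addrC subrK.
have [f [ff fP]] := u_wop w2; rewrite dw2 in ff.
have w2sgn : \prod_(a <- w2) usign a = -1.
  rewrite /w2 /w1 map_rcons -cats1 big_cat big_seq1 /= big_map big_seq.
  rewrite big1 ?mul1r => [|a aw].
    rewrite /usign /lpos /ldeg /= tpermL eqxx ijN mulrN.
    by rewrite -expr2 sqrr_sign.
  rewrite /usign /lpos /= -[X in _ == X](tpermL (lpos z)) (inj_eq perm_inj).
  case: eqP => // e1; case/negP: zw; rewrite -e1.
  exact: (map_f lpos).
have := P_u (wop w2 x); rewrite fP w2sgn; case: (xI) => _ -> Pu.
have := subspaceB PS (P_filt ff Px xI) Pu.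
rewrite scaleN1r [X in P X](_ : _ = 2%:R *: wop w2 x).
  by apply: subspace_scalerI; rewrite ?pnatr_eq0.
by rewrite !opprD !opprK addrA [f x + _]addrCA subrr addr0 scaler_nat mulr2n.
Qed.

Let P_wop_rcons w z x : (size w < s)%N -> (wdeg w + ldeg z)%N = d ->
  P x -> invariant x -> P (wop w (lop z x)).
Proof.
move=> ws wd Px xI.
have [zw|zw] := boolP (lpos z \in map lpos w); first exact: P_merge.
have [ij|] := eqVneq (eps z.2.1 * eps z.2.2) ((-1) ^+ ldeg z); last first.
  by move=> ij; apply: P_wop_parity.
have [x1 [Px1 x1I [c [g [c0 [f [ff fP]]]]]]] := leading_vector Px xI ij.
have wL := wop_lin par yL w.
pose F k := wop w (lop (k, ldeg z, z.2) x).
have zE : (lpos z, ldeg z, z.2) = z by case: (z) => -[].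
have dwz k : wdeg (rcons w (k, ldeg z, z.2)) = d.
  by rewrite -cats1 wdeg_cat /wdeg /= addn0 -wd.
have wopF k : wop (rcons w (k, ldeg z, z.2)) x = F k by rewrite -cats1 wop_cat.
(* Apply [w], which is shorter than the full word, to the invariant vector [x1] of [P]. The scalar
   part of [x1] gives a short word and its error part lower degree, leaving the sum. *)
have PF : P (\sum_k F k).
  apply: (subspace_scalerI PS c0).
  have : P (wop w x1) by apply: P_short => //; rewrite -wd leq_addr.
  have -> : x1 = c *: words_sum (ldeg z) z.2.1 z.2.2 x + g *: x + f x.
    by rewrite -fP addrC subrK.
  rewrite !(is_linD _ _ wL) !(is_linZ _ _ wL) /words_sum (is_lin_sum _ _ wL).
  rewrite -addrA (_ : \sum_k F k = \sum_k wop w (lop (k, ldeg z, (z.2.1, z.2.2)) x)).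
    move=> PF; rewrite -[X in P X](addrK (g *: wop w x + wop w (f x))).
    apply: (subspaceB PS PF); apply: (subspaceD PS).
      by apply: (subspaceZ _ PS); apply: P_short => //; rewrite -wd leq_addr.
    apply: (P_filt (f := wop w \o f)) => //.
    have fw := filt_word par y (ltnSn (wdeg w)).
    by apply: (filt_comp yL _ fw ff); rewrite addSn wd.
  by apply: eq_bigr => k _; rewrite /F -surjective_pairing.
(* A summand at a position occupied by [w] merges; at a free position, transposing it with [lpos z]
   leaves [w] unchanged. *)
have PFk k : P (F k - (k \notin map lpos w)%:R *: F (lpos z)).
  case: (boolP (k \in map lpos w)) => kw /=.
    by rewrite scale0r subr0; apply: P_merge => //.
  rewrite scale1r.
  have := P_tperm (lpos z) k (dwz (lpos z)) Px xI; rewrite wopF.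
  rewrite map_rcons {2}/lmap /lpos /= tpermL -/(lpos z) -/(ldeg z).
  rewrite (_ : map _ w = w) ?wopF // -[RHS]map_id.
  apply/eq_in_map => a aw; rewrite /lmap tpermD //.
  - by case: (a) => -[].
  - by apply: contraNneq zw => ->; apply: (map_f lpos).
  - by apply: contraNneq kw => ->; apply: (map_f lpos).
have Pdiff := subspace_sum (Q := xpredT) PS (fun k _ => PFk k).
have := subspaceB PS PF Pdiff; rewrite sumrB subKr -scaler_suml -natr_sum.
(* The remaining scalar is the number of free positions, nonzero because [lpos z] is free. *)
rewrite /F zE; apply: (subspace_scalerI PS).
by rewrite pnatr_eq0 (bigD1 (lpos z)) //= zw.
Qed.

Lemma P_wop_step w x : wdeg w = d -> size w = s -> P x -> invariant x -> P (wop w x).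
Proof.
case: (lastP w) => [|{}w z] wd ws Px xI //.
rewrite -cats1 wop_cat /=; apply: P_wop_rcons => //.
  by rewrite -ws size_rcons.
by rewrite -wd -cats1 wdeg_cat /wdeg /= addn0.
Qed.

End Induction.

Lemma P_wop w x : P x -> invariant x -> P (wop w x).
Proof.
have [d wd] : exists d, wdeg w = d by eexists.
(* The vector [x] stays general, since the step applies shorter words to another invariant vector of
   [P]. *)
elim/ltn_ind: d w wd x => d IHd w wd x; have [s ws] : exists s, size w = s by eexists.
elim/ltn_ind: s w ws wd x => s IHs w ws wd x Px xI.
apply: (P_wop_step (d := d) (s := s)) => // [v z vd|v z vd vs'] Pz zI.
  exact: (IHd _ vd).
exact: (IHs _ vs').
Qed.

Lemma submodule_full x : P x -> ~ N x -> forall v, P v.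
Proof.
move=> Px nNx v.
have NS : subspace N.
  split=> [Q [Q0 _] _|a v1 v2 N1 N2 Q QS Qi]; first exact: Q0.
  by case: (QS) => _; apply; [apply: N1|apply: N2].
have Ne : N (e x - x).
  apply: (e_near (U := N)) => // [i x' Nx'|x' Nx'].
  - exact: (subspace_subr NS (N_t i x') Nx').
  - exact: (subspace_subr NS (N_u x') Nx').
have Pe : P (e x) := subspace_subr PS (PN Ne) Px.
(* Otherwise [Ne] would place [- x] in [N]. *)
have e0x : e x != 0.
  apply/eqP=> e1; case: nNx; rewrite -[x]scale1r -[1]opprK scaleNr -scalerN.
  by apply: (subspaceZ _ NS); rewrite -[- x]add0r -e1.
have [d [f [ff ->]]] := orbit_full (e_inv x) e0x v.
elim: ff => {f} [w _||a f g _ Pf _ Pg|f g fg _ Pf].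
- exact: P_wop.
- by case: PS.
- by case: PS => _; apply.
- by rewrite -fg.
Qed.

End Submodule.

Lemma Drinfeld_zero_or_irreducible : chi != 0 ->
  @Drinfeld_zero R m n par epsb l M sg vs e0 \/
  @Drinfeld_irreducible R m n par epsb l M sg vs y gam chi e0.
Proof.
move=> chi0; have [|nZ] := boolp.EM (@Drinfeld_zero R m n par epsb l M sg vs e0).
  by left.
right; split=> // P PS PN PB.
have [e [et eu eN]] := symmetrizer tL uL tK t_braid t_far uK uC tu.
have [|/boolp.existsNP[x /boolp.not_implyP[Px nNx]]] :=
  boolp.EM (forall x, P x -> N x); first by left.
by right; apply: (submodule_full PS chi0 PN PB (fun v => conj (et v) (eu v)) eN Px nNx).
Qed.

End DrinfeldModule.

Theorem theorem7p12 (R : realType) (m n : nat) (par epsb : 'I_(m + n)%N -> bool)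
  (l : nat) (M : lmodType R[i]) (sg : 'I_l -> M -> M) (vs y : 'I_l.+1 -> M -> M)
  (th1 th2 gam chi : R[i]) (epsilon : bool) :
  #|[set a | ~~ par a]| = m ->
  th1 != 0 -> th2 != 0 ->
  th2 = th1 * (2%:R * gam + @varpi1 R m n par epsb) ->
  th1 * chi = sgnC R epsilon ->
  is_Hmodule sg vs y th1 th2 ->
  H_irreducible sg vs y ->
  @Drinfeld_zero R m n par epsb l M sg vs (sgnC R epsilon) \/
  @Drinfeld_irreducible R m n par epsb l M sg vs y gam chi (sgnC R epsilon).
Proof.
move=> _ _ _ _ th1chi HM Hirr.
apply: Drinfeld_zero_or_irreducible HM Hirr _; apply/eqP=> chi0.
by have /eqP := th1chi; rewrite chi0 mulr0 eq_sym /sgnC signr_eq0.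
Qed.
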